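(* Let $0<\delta<1$. The QNL diffusion problem $$\begin{cases}-\mathcal{L}^{\rm qnl}_\delta u^{\rm qnl}_\delta(x)=f(x), & x\in\Omega,\\ u^{\rm qnl}_\delta(x)=0, & x\in\Omega_\delta,\end{cases}$$ is well-posed in its variational form: for every bounded linear functional $f$ on $\mathcal{S}^{\rm qnl}_\delta(\Omega)$ (in particular for $f\in L^2(\Omega)$, acting by $\langle f,v\rangle=\int_\Omega fv\,dx$) there is a unique $u^{\rm qnl}_\delta\in\mathcal{S}^{\rm qnl}_\delta(\Omega)$ such that $$b^{\rm qnl}_\delta(u^{\rm qnl}_\delta,v)=\langle f,v\rangle\qquad\text{for all }v\in\mathcal{S}^{\rm qnl}_\delta(\Omega),$$ and there is a constant $C$ independent of $f$ with $\|u^{\rm qnl}_\delta\|_{\mathcal{S}^{\rm qnl}_\delta(\Omega)}\le C\|f\|_{(\mathcal{S}^{\rm qnl}_\delta(\Omega))^*}$.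
   Context: $\Omega=(-1,1)$ and $\Omega_\delta=(-1-\delta,-1)\cup\{1\}$. The kernel is $\gamma_\delta(s)=\gamma_\delta(|s|)=\delta^{-3}\gamma(|s|/\delta)$ for $s\in\mathbb{R}$, where $\gamma\ge 0$ is nonincreasing on $(0,1)$, is supported in $[0,1]$ (i.e. $\gamma(r)=0$ for $r>1$), and satisfies $\int_{\mathbb{R}}|s|^2\gamma(|s|)\,ds=1$. The weight is $\omega_\delta(x)=\int_0^1 dt\int_{|s|<x/t}|s|^2\gamma_\delta(|s|)\,ds$ for $x>0$ (so $\omega_\delta=1$ on $[\delta,\infty)$). Functions are extended by zero outside $\Omega\cup\Omega_\delta$; $u'$ is the weak derivative on $(0,\infty)$. The bilinear form is $$b^{\rm qnl}_\delta(u,v)=\iint_{x\le 0\text{ or }y\le 0}\gamma_\delta(|y-x|)(u(y)-u(x))(v(y)-v(x))\,dy\,dx+\int_{x>0}u'(x)v'(x)\,\omega_\delta(x)\,dx .$$ Set $|u|^2_{\mathcal{S}^{\rm qnl}_\delta(\Omega)}=b^{\rm qnl}_\delta(u,u)$ and $\|u\|^2_{\mathcal{S}^{\rm qnl}_\delta(\Omega)}=\|u\|^2_{L^2(\Omega\cup\Omega_\delta)}+|u|^2_{\mathcal{S}^{\rm qnl}_\delta(\Omega)}$. The energy space $\mathcal{S}^{\rm qnl}_\delta(\Omega)$ is the completion of $C_c^\infty(\Omega)$ in this norm, i.e. the set of $u\in L^2(\Omega\cup\Omega_\delta)$ for which there are $u_n\in C_c^\infty(\Omega)$ with $\|u_n-u\|_{\mathcal{S}^{\rm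 qnl}_\delta(\Omega)}\to 0$; it is a Hilbert space. The operator $\mathcal{L}^{\rm qnl}_\delta$ is minus the first variation of the energy $\frac12 b^{\rm qnl}_\delta(u,u)$; pointwise, $$\mathcal{L}^{\rm qnl}_\delta u(x)=\begin{cases}2\int_{\mathbb{R}}\gamma_\delta(|y-x|)(u(y)-u(x))\,dy, & x\le 0,\\ 2\int_{y<0}\gamma_\delta(|y-x|)(u(y)-u(x))\,dy+(\omega_\delta u')'(x), & 0<x\le\delta,\\ u''(x), & x>\delta.\end{cases}$$ *)

(* Defs.v *)
From mathcomp Require Import all_boot all_order all_algebra.
From mathcomp Require Import all_classical all_reals all_analysis.

Set Implicit Arguments.
Unset Strict Implicit.
Unset Printing Implicit Defensive.

Import Order.TTheory GRing.Theory Num.Theory.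
Import numFieldNormedType.Exports.

Local Open Scope classical_set_scope.
Local Open Scope ring_scope.

Section FunctionSpaces.
Context {R : realType}.
Implicit Types (D : set R) (u g phi : R -> R).
Local Notation mu := (@lebesgue_measure R).

Definition L2 D u : Prop := u \_ D \in Lfun mu 2%:E.

Definition test_function D phi : Prop :=
  [/\ forall n x, derivable (derive1n n phi) x 1,
      compact (closure [set x | phi x != 0]) &
      closure [set x | phi x != 0] `<=` D].

Definition is_weak_derivative D u g : Prop :=
  [/\ locally_integrable D u, locally_integrable D g &
      forall phi, test_function D phi ->
        \int[mu]_(x in D) (u x * derive1 phi x) =
        - \int[mu]_(x in D) (g x * phi x)].

Definition weakly_differentiable D u : Prop :=
  exists g, is_weak_derivative D u g.

(* Some weak derivative of [u] on [D]; it is determined up to a null subset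
   of [D], and is junk when [u] is not weakly differentiable. *)
Definition weak_derivative D u : R -> R :=
  xget (cst 0) [set g | is_weak_derivative D u g].

End FunctionSpaces.

Section QNL.
Context {R : realType}.
Local Notation mu := (@lebesgue_measure R).

(* Only the values of [gamma] on [0, +oo[ matter; its value at 0 plays no role,
   so it may be singular there.  Monotonicity makes it Borel measurable. *)
Definition admissible_kernel (gamma : R -> R) : Prop :=
  [/\ forall r, 0 <= r -> 0 <= gamma r,
      forall r s, 0 < r -> r <= s -> s < 1 -> gamma s <= gamma r,
      forall r, 1 < r -> gamma r = 0 &
      (\int[mu]_s (`|s| ^+ 2 * gamma `|s|)%:E = 1)%E].

Variables (gamma : R -> R) (delta : R).

Definition Omega : set R := `]-1, 1[.

Definition half_line : set R := `]0, +oo[.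

Definition Omega_delta : set R := `]-1 - delta, -1[ `|` [set 1].

Definition gamma_delta (s : R) : R := delta ^- 3 * gamma (`|s| / delta).

Definition omega_delta (x : R) : R :=
  \int[mu]_(t in `]0, 1[)
    \int[mu]_(s in [set s | `|s| < x / t]) (`|s| ^+ 2 * gamma_delta s).

(* Extended-real valued, so that [b_qnl u u] is +oo when the energy of [u] is
   infinite. *)
Definition b_qnl (u v : R -> R) : \bar R :=
  (\int[mu \x mu]_(p in [set p : R * R | (p.1 <= 0)%R \/ (p.2 <= 0)%R])
     (gamma_delta `|p.2 - p.1| * (u p.2 - u p.1) * (v p.2 - v p.1))%:E +
   \int[mu]_(x in half_line)
     (weak_derivative half_line u x * weak_derivative half_line v x *
      omega_delta x)%:E)%E.

Definition qnl_norm (u : R -> R) : \bar R :=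
  sqrte ('N[mu]_2%:E[EFin \o (u \_ (Omega `|` Omega_delta))] ^+ 2 + b_qnl u u)%E.

(* Elements are represented by functions on the line that vanish outside
   [Omega `|` Omega_delta]; almost everywhere equal functions represent the
   same element.  [weakly_differentiable] is needed for the norm of
   [u_ n \- u] to be meaningful. *)
Definition energy_space : set (R -> R) :=
  [set u | [/\ forall x, ~ (Omega `|` Omega_delta) x -> u x = 0,
               L2 (Omega `|` Omega_delta) u,
               weakly_differentiable half_line u &
               exists u_ : nat -> R -> R,
                 (forall n, test_function Omega (u_ n)) /\
                 qnl_norm (u_ n \- u) @[n --> \oo] --> 0%E]].

Definition bounded_linear_functional (F : (R -> R) -> R) : Prop :=
  (forall (a : R) u v, energy_space u -> energy_space v ->
     F (a \*: u \+ v) = a * F u + F v) /\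
  (exists M : R, forall v, energy_space v ->
     (`|F v|%:E <= M%:E * qnl_norm v)%E).

Definition dual_norm (F : (R -> R) -> R) : \bar R :=
  ereal_sup [set (`|F v|)%:E | v in
    [set v | energy_space v /\ (qnl_norm v <= 1)%E]].

Definition variational_solution (F : (R -> R) -> R) (u : R -> R) : Prop :=
  energy_space u /\ forall v, energy_space v -> b_qnl u v = (F v)%:E.

End QNL.

(* Main.v *)
Require Import Defs.
From mathcomp Require Import all_boot all_order all_algebra.
From mathcomp Require Import all_classical all_reals all_analysis.
From mathcomp Require Import measurable_realfun.
From mathcomp Require Import ring lra.

Import Order.TTheory GRing.Theory Num.Theory.
Import numFieldNormedType.Exports.

Local Open Scope classical_set_scope.
Local Open Scope ring_scope.

Set Implicit Arguments.
Unset Strict Implicit.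
Unset Printing Implicit Defensive.

(** On the energy space the form is bounded and coercive, and the space is
    complete for the energy; the solution is then given by a Riesz
    representation argument. Coercivity and completeness carry the specifics.

    Coercivity is a Poincare inequality for test functions phi, on both sides
    of a point h in ]0, 1[. On the left the nonlocal term controls phi: the
    kernel is bounded below near 0 by some c > 0, so the mass of phi on a cell
    of length h is bounded by its mass on the cell just before and by the
    nonlocal energy ([nonlocal_step]). Starting from the cells before -1, where
    phi vanishes, finitely many steps reach h; the last one crosses the
    interface from [-h, 0[ to [0, h[, and pairs of points in these two cells
    still belong to the region of interaction ([nonlocal_poincare]). On the
    right of h the nondecreasing weight is at least its value at h, which is
    positive, and phi vanishes at 1: there the classical one-dimensional
    inequality applies ([local_poincare]).

    For completeness, the squared norm of u is written as the sum of the
    squared L2 norms of u, of sqrt(gamma_delta (y - x)) (u y - u x) on the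
    region of interaction, and of sqrt(omega_delta) u' on the half line. Along
    a fast subsequence of a Cauchy sequence of test functions, the first and
    the last converge almost everywhere ([L2_fast_cauchy_ae]), hence so does the
    second. Fatou's lemma bounds the three parts of the distance to the limit
    u, and the limit of sqrt(omega_delta) u_n' divided by sqrt(omega_delta) is a
    weak derivative of u since the weight is bounded away from 0 on compact
    subsets of the half line ([is_weak_derivative_limit],
    [energy_sobolev_complete]).

    As [weak_derivative] is an arbitrary choice, the energy is bilinear only
    because weak derivatives are unique almost everywhere; this is the
    fundamental lemma of the calculus of variations ([fundamental_lemma]),
    which requires smooth bump functions, built from exp (-1/x).

    The limits produced by [energy_sobolev_complete] vanish outside Omega, so
    the solution does too. Two solutions differ by a function of zero energy,
    hence of zero L2 norm by coercivity. The estimate by the dual norm comes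
    from evaluating F on the normalised solution. *)

(** * Riesz representation for semidefinite forms *)

Section riesz.
Context {R : realType} {V : lmodType R}.
Implicit Types (E T : set V) (B : V -> V -> R).

Definition subspace E := E 0 /\ forall a u v, E u -> E v -> E (a *: u + v).

(** The forms considered below are integrals, with no meaning outside some
    subspace E: all conditions are relative to E. *)
Definition psd_form E B :=
  [/\ forall u v, E u -> E v -> B u v = B v u,
      forall a u v w, E u -> E v -> E w -> B (a *: u + v) w = a * B u w + B v w &
      forall u, E u -> 0 <= B u u].

Definition functional E (F : V -> R) :=
  forall a u v, E u -> E v -> F (a *: u + v) = a * F u + F v.

Lemma subspaceB E u v : subspace E -> E u -> E v -> E (u - v).
Proof. by move=> [_ h] Eu Ev; rewrite addrC -scaleN1r; exact: h. Qed.

Lemma subspaceZ E a u : subspace E -> E u -> E (a *: u).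
Proof. by move=> [E0 h] Eu; rewrite -[_ *: _]addr0; exact: h. Qed.

Lemma subspaceD E u v : subspace E -> E u -> E v -> E (u + v).
Proof. by move=> [_ h] Eu Ev; rewrite -[u]scale1r; exact: h. Qed.

Lemma functionalZ E (F : V -> R) a u : subspace E -> functional E F -> E u ->
  F (a *: u) = a * F u.
Proof.
move=> sE lF Eu; have E0 := sE.1.
have F0 : F 0 = 0.
  by have := lF (-1) 0 0 E0 E0; rewrite scaler0 addr0 mulN1r addNr.
by rewrite -[a *: u]addr0 lF// F0 addr0.
Qed.

Lemma ge0_quadratic (a d c : R) : 0 <= a ->
  (forall t, 0 <= a * t ^+ 2 + 2 * d * t + c) -> d ^+ 2 <= a * c.
Proof.
rewrite le_eqVlt => /orP[/eqP <-|a0] h.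
  rewrite mul0r; have [->|d0] := eqVneq d 0; first by rewrite expr0n.
  (* At this point the affine function 2 d t + c takes the value -1. *)
  have := h (- (c + 1) / (2 * d)).
  suff -> : 0 * (- (c + 1) / (2 * d)) ^+ 2 + 2 * d * (- (c + 1) / (2 * d)) + c
    = -1 by lra.
  by field.
(* The minimum of the quadratic. *)
have := h (- d / a).
have -> : a * (- d / a) ^+ 2 + 2 * d * (- d / a) + c = c - d ^+ 2 / a.
  by field; rewrite gt_eqF.
by rewrite subr_ge0 ler_pdivrMr// mulrC.
Qed.

Lemma sqrB_le (x y : R) : (x - y) ^+ 2 <= 2 * x ^+ 2 + 2 * y ^+ 2.
Proof. by have := sqr_ge0 (x + y); rewrite sqrrB sqrrD; lra. Qed.

Section form.
Context E B (sE : subspace E) (fB : psd_form E B).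

Let lin a u v w : E u -> E v -> E w -> B (a *: u + v) w = a * B u w + B v w.
Proof. by case: fB => _ + _; exact. Qed.
Let sym u v : E u -> E v -> B u v = B v u. Proof. by case: fB => + _ _; exact. Qed.

Lemma psd_ge0 u : E u -> 0 <= B u u. Proof. by case: fB => _ _; exact. Qed.

Lemma psd_sqrD a u v : E u -> E v ->
  B (a *: u + v) (a *: u + v) = B u u * a ^+ 2 + 2 * B u v * a + B v v.
Proof.
move=> Eu Ev; have Ew : E (a *: u + v) by apply sE.2.
rewrite lin// (sym Eu Ew) (sym Ev Ew) !lin// (sym Ev Eu); ring.
Qed.

Lemma psd_cauchy_schwarz u v : E u -> E v -> B u v ^+ 2 <= B u u * B v v.
Proof.
move=> Eu Ev; apply: ge0_quadratic; first exact: psd_ge0.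
by move=> t; rewrite -psd_sqrD// psd_ge0//; apply sE.2.
Qed.

Lemma psd_form0 : B 0 0 = 0.
Proof.
have := @lin (-1) 0 0 0 sE.1 sE.1 sE.1.
by rewrite scaler0 addr0 mulN1r addNr.
Qed.

Lemma psd_sqrZ a u : E u -> B (a *: u) (a *: u) = a ^+ 2 * B u u.
Proof.
move=> Eu; have E0 := sE.1; rewrite -[a *: u]addr0 psd_sqrD// psd_form0.
have : B u 0 ^+ 2 <= 0 by have := psd_cauchy_schwarz Eu E0; rewrite psd_form0 mulr0.
move=> h; have /eqP : B u 0 ^+ 2 == 0 by rewrite eq_le h sqr_ge0.
by move/eqP; rewrite sqrf_eq0 => /eqP ->; ring.
Qed.

Lemma psd_sqrDE u v : E u -> E v -> B (u + v) (u + v) = B u u + 2 * B u v + B v v.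
Proof. by move=> Eu Ev; rewrite -[u in LHS]scale1r psd_sqrD// expr1n !mulr1. Qed.

Lemma psd_sqrBE u v : E u -> E v -> B (u - v) (u - v) = B u u - 2 * B u v + B v v.
Proof.
by move=> Eu Ev; rewrite addrC -scaleN1r psd_sqrD// (sym Ev Eu); ring.
Qed.

Lemma psd_sqrD_le u v : E u -> E v -> B (u + v) (u + v) <= 2 * B u u + 2 * B v v.
Proof.
move=> Eu Ev; have := psd_ge0 (subspaceB sE Eu Ev).
by rewrite psd_sqrBE// psd_sqrDE//; lra.
Qed.

Lemma psd_sqrB_sym u v : E u -> E v -> B (u - v) (u - v) = B (v - u) (v - u).
Proof. by move=> Eu Ev; rewrite !psd_sqrBE// (sym Eu Ev); ring. Qed.

End form.

Lemma psd_formBl E B u v w : psd_form E B -> E u -> E v -> E w ->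
  B (u - v) w = B u w - B v w.
Proof.
by move=> [_ lin _] Eu Ev Ew; rewrite addrC -scaleN1r lin// mulN1r addrC.
Qed.

Lemma psd_formS E E' B : E' `<=` E -> psd_form E B -> psd_form E' B.
Proof.
move=> EE [s l p]; split=> [u v /EE Eu /EE Ev|a u v w /EE Eu /EE Ev /EE Ew|u /EE Eu].
- exact: s.
- exact: l.
- exact: p.
Qed.

Lemma psd_form_sum E B1 B2 :
  psd_form E B1 -> psd_form E B2 -> psd_form E (fun u v => B1 u v + B2 u v).
Proof.
move=> [s1 l1 p1] [s2 l2 p2]; split=> [u v Eu Ev|a u v w Eu Ev Ew|u Eu].
- by rewrite s1// s2.
- by rewrite l1// l2//; ring.
- by rewrite addr_ge0 ?p1 ?p2.
Qed.

Lemma le_inv_cvg0 (a b : R) : 0 <= b -> (forall n : nat, a <= b / n.+1%:R) -> a <= 0.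
Proof.
move=> b0 h; rewrite leNgt; apply/negP => a0.
have [n] := ltr_add_invr a0; rewrite add0r => hn.
have := archimedean.Num.Theory.archi_boundP (divr_ge0 b0 (ltW a0)).
set N := Num.bound _ => hN.
have := h N; rewrite leNgt => /negP; apply.
rewrite ltr_pdivrMr// mulrC -ltr_pdivrMr//.
by rewrite (lt_trans hN)// ltr_nat.
Qed.

Lemma div_succ_lt (c e : R) : 0 <= c -> 0 < e ->
  exists N, forall n, (N <= n)%N -> c / n.+1%:R < e.
Proof.
move=> c0 e0; exists (Num.bound (c / e)) => n Nn.
rewrite ltr_pdivrMr ?ltr0n// mulrC -ltr_pdivrMr//.
apply: lt_le_trans (archi_boundP _) _; first by rewrite divr_ge0// ltW.
by rewrite ler_nat; exact: leqW.
Qed.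

(** Dirichlet's principle: a minimising sequence of B v v - 2 F v in T is
    Cauchy by the parallelogram law, and the first variation vanishes at its
    limit. Completeness is only required of sequences of the dense subspace T
    at the rate that the minimisation provides; Z records extra information on
    the limit. *)
Lemma riesz_representation E T B (F : V -> R) (Z : set V) (M : R) :
  subspace E -> subspace T -> T `<=` E -> psd_form E B ->
  functional E F -> 0 <= M -> (forall v, E v -> F v ^+ 2 <= M * B v v) ->
  (forall v, E v -> forall e : R, 0 < e -> exists2 w, T w & B (v - w) (v - w) < e) ->
  (forall u_ : nat -> V, (forall n, T (u_ n)) ->
     (forall m n : nat, B (u_ m - u_ n) (u_ m - u_ n) <= 2 / m.+1%:R + 2 / n.+1%:R) ->
     exists u, [/\ E u, Z u & forall e : R, 0 < e ->
       exists N, forall n, (N <= n)%N -> B (u_ n - u) (u_ n - u) < e]) ->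
  exists u, [/\ E u, Z u & forall v, E v -> B u v = F v].
Proof.
move=> sE sT TE fB lF M0 bF dense complete.
pose J v := B v v - 2 * F v.
have symB : forall u v, E u -> E v -> B u v = B v u by case: fB.
have linB : forall a u v w, E u -> E v -> E w -> B (a *: u + v) w = a * B u w + B v w.
  by case: fB.
have B0 u : E u -> 0 <= B u u by exact: (psd_ge0 fB).
have JM v : E v -> - M <= J v.
  move=> Ev; rewrite /J; have := bF _ Ev; have := B0 _ Ev.
  set b := B v v; set f := F v => b0 fM.
  rewrite lerBrDl addrC -lerBrDl opprK.
  suff : 2 * f <= b + M by lra.
  rewrite leNgt; apply/negP => fbM.
  have : 0 < (2 * f - (b + M)) * (2 * f + (b + M)) by apply: mulr_gt0; lra.
  by have := sqr_ge0 (b - M); nra.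
pose A := [set J v | v in T].
have infA : has_inf A.
  split; first by exists (J 0), 0 => //; exact: sT.1.
  by exists (- M) => _ [v Tv <-]; exact/JM/TE.
have approx n : exists v, T v /\ J v < inf A + n.+1%:R^-1.
  have [_ [v Tv <-] h] := @inf_adherent _ A n.+1%:R^-1 ltac:(by rewrite invr_gt0) infA.
  by exists v.
have [u_ /all_and2[Tu Ju]] := choice approx.
have infJ v : T v -> inf A <= J v.
  by move=> Tv; apply: ge_inf; [exact: infA.2|exists v].
have cauchy m n : B (u_ m - u_ n) (u_ m - u_ n) <= 2 / m.+1%:R + 2 / n.+1%:R.
  have Em := TE _ (Tu m); have En := TE _ (Tu n).
  (* The midpoint of u_m and u_n is a competitor in the minimisation. *)
  have := infJ _ (subspaceZ (2^-1) sT (subspaceD sT (Tu m) (Tu n))).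
  have := Ju m; have := Ju n; rewrite /J.
  rewrite (psd_sqrBE sE fB)// (psd_sqrZ sE fB) ?(psd_sqrDE sE fB)//.
    2: exact: subspaceD.
  have -> : F (2^-1 *: (u_ m + u_ n)) = 2^-1 * (F (u_ m) + F (u_ n)).
    rewrite (functionalZ _ sE lF); last exact: subspaceD.
    by rewrite -[X in F (X + _)]scale1r lF// mul1r.
  have -> : (2^-1 : R) ^+ 2 = 4^-1 by rewrite exprVn; congr (_ ^-1); ring.
  have arith (a b c f g i p q : R) : b - 2 * g < i + q -> a - 2 * f < i + p ->
      i <= 4^-1 * (a + 2 * c + b) - 2 * (2^-1 * (f + g)) ->
      a - 2 * c + b <= 2 * p + 2 * q by lra.
  exact: arith.
have [u [Eu Zu cu]] := complete u_ Tu cauchy.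
exists u; split => // v Ev.
(* Near a minimiser J is almost stationary: u_n + t w is a competitor for
   every t. *)
have stat n w : T w -> (B (u_ n) w - F w) ^+ 2 <= B w w / n.+1%:R.
  move=> Tw; apply: ge0_quadratic; first exact/B0/TE.
  move=> t; have := infJ _ (sT.2 t _ _ Tw (Tu n)); have := Ju n.
  rewrite /J (psd_sqrD sE fB)//; try exact: TE.
  rewrite lF ?(symB w (u_ n))//; try exact: TE.
  have arith (a b c d f g i q : R) : a - 2 * g < i + q ->
      i <= b * c ^+ 2 + 2 * d * c + a - 2 * (c * f + g) ->
      0 <= b * c ^+ 2 + 2 * (d - f) * c + q by lra.
  exact: arith.
have CS := psd_cauchy_schwarz sE fB.
have critT w : T w -> B u w = F w.
  move=> Tw; have Ew := TE _ Tw; apply/eqP; rewrite -subr_eq0 -sqrf_eq0.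
  rewrite eq_le sqr_ge0 andbT.
  apply: (@le_inv_cvg0 _ (4 * B w w)) => [|n]; first by rewrite mulr_ge0 ?B0.
  have [N /(_ (maxn N n) (leq_maxl _ _))] := cu (n.+1%:R^-1) ltac:(by rewrite invr_gt0).
  set m := maxn N n => bm.
  have Em := TE _ (Tu m).
  have -> : B u w - F w = (B (u_ m) w - F w) - B (u_ m - u) w.
    by rewrite [u_ m - u]addrC -scaleN1r linB//; ring.
  have h1 := stat m w Tw.
  have h2 := CS _ _ (subspaceB sE Em Eu) Ew.
  have h3 : B w w / m.+1%:R <= B w w / n.+1%:R.
    by rewrite ler_wpM2l ?B0// lef_pV2 ?posrE// ler_nat ltnS leq_maxr.
  have h4 : B (u_ m - u) (u_ m - u) * B w w <= B w w / n.+1%:R.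
    by rewrite mulrC ler_wpM2l ?B0// ltW.
  apply: (le_trans (sqrB_le _ _)).
  have -> : 4 * B w w / n.+1%:R = 2 * (B w w / n.+1%:R) + 2 * (B w w / n.+1%:R).
    by ring.
  by rewrite lerD// ler_wpM2l//; [exact: le_trans h1 h3|exact: le_trans h2 h4].
apply/eqP; rewrite -subr_eq0 -sqrf_eq0 eq_le sqr_ge0 andbT.
apply: (@le_inv_cvg0 _ (2 * B u u + 2 * M)) => [|n].
  by rewrite addr_ge0// mulr_ge0// B0.
have [w Tw bw] := dense v Ev (n.+1%:R^-1) ltac:(by rewrite invr_gt0).
have Ew := TE _ Tw.
have -> : B u v - F v = B u (v - w) - F (v - w).
  have -> : B u (v - w) = B u v - B u w.
    rewrite symB//; last exact: subspaceB.
    rewrite [v - w]addrC -scaleN1r linB// (symB v u)// (symB w u)//.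
    by rewrite mulN1r addrC.
  by rewrite [v - w]addrC -(scaleN1r w) lF// (critT w)//; ring.
have Evw := subspaceB sE Ev Ew.
have h1 := CS _ _ Eu Evw; have h2 := bF _ Evw.
have h3 : (B u u + M) * B (v - w) (v - w) <= (B u u + M) / n.+1%:R.
  by rewrite ler_wpM2l ?addr_ge0 ?B0// ltW.
apply: (le_trans (sqrB_le _ _)).
have -> : (2 * B u u + 2 * M) / n.+1%:R = 2 * ((B u u + M) / n.+1%:R) by ring.
rewrite -mulrDr ler_wpM2l//; apply: le_trans h3; rewrite mulrDl.
exact: lerD.
Qed.

End riesz.

(** * Square-integrable functions *)

Lemma integrable_patch d (T : measurableType d) (R : realType)
    (mu : {measure set T -> \bar R}) (D E : set T) (f : T -> R) :
  measurable E -> mu.-integrable E (EFin \o f) -> measurable D ->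
  mu.-integrable D (EFin \o (f \_ E)).
Proof.
move=> mE iE mD; have := (integrable_mkcond (EFin \o f) mE).1 iE.
by rewrite restrict_EFin; apply: integrableS.
Qed.

Lemma measurable_sqrt (R : realType) : measurable_fun setT (@Num.sqrt R).
Proof. by apply: continuous_measurable_fun; exact: sqrt_continuous. Qed.

Lemma fct_linE (R : realType) (T : Type) (a : R) (u v : T -> R) x :
  (a *: u + v) x = a * u x + v x.
Proof. by []. Qed.

Section square_integrable.
Context d (T : measurableType d) (R : realType).
Variable mu : {measure set T -> \bar R}.
Implicit Types f g : T -> R.

(** The squared L2 norm is extended real so as to make sense for every
    measurable function; [L2ip] is its polarisation on [L2set]. *)
Definition sqint f : \bar R := (\int[mu]_x (f x ^+ 2)%:E)%E.
Definition L2ip f g : R := \int[mu]_x (f x * g x).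
Definition L2set : set (T -> R) := [set f | f \in Lfun mu 2%:E].

Lemma sqint_ge0 f : (0 <= sqint f)%E.
Proof. by apply: integral_ge0 => x _; rewrite lee_fin sqr_ge0. Qed.

Lemma Lnorm2_sqr f : ('N[mu]_2%:E[EFin \o f] ^+ 2 = sqint f)%E.
Proof.
rewrite unlock /= poweR12_sqrt; last first.
  by apply: integral_ge0 => x _; rewrite lee_fin powR_ge0.
rewrite -expe2 sqr_sqrte; last by apply: integral_ge0 => x _; rewrite lee_fin powR_ge0.
by apply: eq_integral => x _; rewrite powR_mulrn// real_normK ?num_real.
Qed.

Lemma L2setP f : L2set f <-> measurable_fun setT f /\ (sqint f < +oo)%E.
Proof.
split=> [lf|[mf sf]].
  split; first by have := sub_Lfun_mfun lf; rewrite inE.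
  have /integrableP[_] := Lfun2_integrable_sqr lf.
  by under eq_integral do rewrite /= ger0_norm ?sqr_ge0//.
rewrite /L2set/= inE; apply/andP; split; rewrite inE//=/finite_norm.
have := Lnorm_ge0 mu 2%:E (EFin \o f); have := Lnorm2_sqr f.
move: ('N[mu]_2%:E[EFin \o f])%E => [r||] //; rewrite ?ltry//.
by move=> h; move: sf; rewrite -h expe2 mulyy.
Qed.

Lemma L2set_measurable f : L2set f -> measurable_fun setT f.
Proof. by move=> /L2setP[]. Qed.

Lemma L2_integrable f g : L2set f -> L2set g ->
  mu.-integrable setT (EFin \o (fun x => f x * g x)).
Proof. by move=> lf lg; apply/Lfun1_integrable; exact: Lfun2_mul_Lfun1. Qed.

Lemma L2ipC f g : L2ip f g = L2ip g f.
Proof. by apply: eq_Rintegral => x _; rewrite mulrC. Qed.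

Lemma L2ipE f g : L2set f -> L2set g ->
  (\int[mu]_x (f x * g x)%:E = (L2ip f g)%:E)%E.
Proof. by move=> lf lg; rewrite fineK// integrable_fin_num//; exact: L2_integrable. Qed.

Lemma sqintE f : L2set f -> sqint f = (L2ip f f)%:E.
Proof. by move=> lf; rewrite -L2ipE//; apply: eq_integral => x _; rewrite expr2. Qed.

Lemma subspace_L2set : subspace L2set.
Proof.
have [h0 hl] := Lfun_submod_closed mu (lee1n 2).
by split=> // a u v Eu Ev; exact: hl.
Qed.

Lemma psd_L2ip : psd_form L2set L2ip.
Proof.
split=> [u v Eu Ev|a u v w Eu Ev Ew|u Eu].
- exact: L2ipC.
- rewrite /L2ip -RintegralZl//; last exact: L2_integrable.
  rewrite -RintegralD//; [|exact: integrableZl (L2_integrable _ _)|exact: L2_integrable].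
  by apply: eq_Rintegral => x _; rewrite mulrDl -mulrA.
- by apply: Rintegral_ge0 => x _; rewrite -expr2 sqr_ge0.
Qed.

Lemma sqint_ae f g : measurable_fun setT f -> measurable_fun setT g ->
  {ae mu, forall x, f x = g x} -> sqint f = sqint g.
Proof.
move=> mf mg fg; apply: ge0_ae_eq_integral => //.
- by apply/measurable_EFinP; exact: measurable_funX.
- by apply/measurable_EFinP; exact: measurable_funX.
- by move=> x _; rewrite lee_fin sqr_ge0.
- by move=> x _; rewrite lee_fin sqr_ge0.
- by apply: filterS fg => x /= ->.
Qed.

Lemma L2set_ae f g : measurable_fun setT f -> {ae mu, forall x, f x = g x} ->
  L2set g -> L2set f.
Proof.
move=> mf fg /L2setP[mg sg]; apply/L2setP; split => //.
by rewrite (sqint_ae mf mg fg).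
Qed.

Lemma L2ip_ae f f' g : measurable_fun setT f -> measurable_fun setT f' ->
  measurable_fun setT g ->
  {ae mu, forall x, f x = f' x} -> L2ip f g = L2ip f' g.
Proof.
move=> mf mf' mg ff'; rewrite /L2ip /Rintegral; congr fine.
apply: ae_eq_integral => //.
- by apply/measurable_EFinP; exact: measurable_funM.
- by apply/measurable_EFinP; exact: measurable_funM.
- by apply: filterS ff' => x /= ->.
Qed.

Lemma bounded_L2set (D : set T) (M : R) f : measurable D -> (mu D < +oo)%E ->
  measurable_fun setT f -> (forall x, `|f x| <= M) ->
  (forall x, ~ D x -> f x = 0) -> L2set f.
Proof.
move=> mD finD mf fM f0; apply/L2setP; split => //.
apply: (@le_lt_trans _ _ (\int[mu]_x (M ^+ 2 * \1_D x)%:E)%E).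
  apply: ge0_le_integral => //.
  - by move=> x _; rewrite lee_fin sqr_ge0.
  - by apply/measurable_EFinP; exact: measurable_funX.
  - by apply/measurable_EFinP; apply: measurable_funM.
  - move=> x _; rewrite lee_fin indicE; have [|xO] := boolP (x \in D).
      rewrite mulr1 -(real_normK (num_real (f x))) => _.
      by rewrite lerXn2r ?nnegrE// (le_trans _ (fM x)).
    by move: xO; rewrite notin_setE => xO; rewrite f0// expr0n mulr0.
under eq_integral do rewrite EFinM.
rewrite ge0_integralZl_EFin ?sqr_ge0//; last first.
  by apply/measurable_EFinP; exact: (measurable_indic mD).
by rewrite integral_indic// setIT lte_mul_pinfty ?lee_fin ?sqr_ge0.
Qed.

Lemma L2set_integrable f (D : set T) : L2set f -> measurable D -> (mu D < +oo)%E ->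
  mu.-integrable D (EFin \o f).
Proof.
move=> Lf mD finD.
have L1 : L2set (\1_D : T -> R).
  apply: (@bounded_L2set D 1) => //.
    by move=> x; rewrite indicE; case: (_ \in _); rewrite ?normr1 ?normr0.
  by move=> x xD; rewrite indicE memNset.
apply: eq_integrable (integrableS measurableT mD _ (L2_integrable Lf L1)) => //.
by move=> x xD; rewrite /= indicE xD mulr1.
Qed.

Lemma sqint_eq0 f : measurable_fun setT f -> sqint f = 0%E ->
  {ae mu, forall x, f x = 0}.
Proof.
move=> mf sf.
have /ae_eq_integral_abs H : measurable_fun setT (fun x => (f x ^+ 2)%:E).
  by apply/measurable_EFinP; exact: measurable_funX.
have /H : (\int[mu]_x `|(f x ^+ 2)%:E| = 0)%E.
  by rewrite -sf; apply: eq_integral => x _; rewrite /= ger0_norm// sqr_ge0.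
move=> h; have {h} := h measurableT.
by apply: filterS => x /= /(_ I) [] /eqP; rewrite sqrf_eq0 => /eqP.
Qed.

(** Lower semicontinuity of the L2 norm turns a Cauchy estimate into an
    estimate of the distance to the almost everywhere limit. *)
Lemma sqint_fatou (f_ : nat -> T -> R) f c :
  (forall n, measurable_fun setT (f_ n)) -> measurable_fun setT f ->
  {ae mu, forall x, f_ ^~ x @ \oo --> f x} ->
  (\forall n \near \oo, sqint (f_ n) <= c)%E -> (sqint f <= c)%E.
Proof.
move=> mf_ mf cf [N _ bf].
pose g n x := (f_ (N + n)%N x ^+ 2)%:E.
have mg n : measurable_fun setT (g n).
  by apply/measurable_EFinP; exact: measurable_funX.
have g0 n x : setT x -> (0 <= g n x)%E by rewrite lee_fin sqr_ge0.
have := fatou mu measurableT mg g0.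
rewrite [X in (X <= _)%E](_ : _ = sqint f); last first.
  apply: ge0_ae_eq_integral => //.
  - apply: measurableT_comp => //; apply: measurable_fun_limn_esup => n.
    by apply: measurableT_comp => //; exact: mg.
  - by apply/measurable_EFinP; exact: measurable_funX.
  - move=> x _; rewrite limn_einf_lim; apply: lime_ge; first exact: is_cvg_einfs.
    by apply: nearW => n; apply: le_ereal_inf_tmp => _ [m _ <-]; exact: g0.
  - by move=> x _; rewrite lee_fin sqr_ge0.
  - apply: filterS cf => x cfx _.
    have : g ^~ x @ \oo --> (f x ^+ 2)%:E.
      apply: cvg_EFin; first by near=> n.
      have cN : f_ (N + n)%N x @[n --> \oo] --> f x.
        under eq_fun do rewrite addnC.
        by have := cfx; rewrite -(cvg_shiftn N).
      rewrite /= (_ : fine \o _ = (fun n => f_ (N + n)%N x * f_ (N + n)%N x)).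
        by rewrite expr2; exact: cvgM.
      by apply/funext => n/=; rewrite expr2.
    by move=> /cvg_limn_einf_sup[].
move=> /le_trans; apply; rewrite limn_einf_lim.
apply: lime_le; first exact: is_cvg_einfs.
near=> n; apply: ereal_inf_le; exists (\int[mu]_x g n x)%E.
  by exists n => /=.
by apply: bf => /=; rewrite leq_addr.
Unshelve. all: by end_near. Qed.

Lemma fast_cauchy_cvg (x_ : nat -> R) (M : R) :
  (forall k : nat, 4 ^+ k * (x_ k.+1 - x_ k) ^+ 2 <= M) -> cvgn x_.
Proof.
move=> h.
have M0 : 0 <= M by apply: le_trans (h 0%N); rewrite expr0 mul1r sqr_ge0.
have step k : `|x_ k.+1 - x_ k| <= (1 + M) * 2^-1 ^+ k.
  rewrite exprVn ler_pdivlMr ?exprn_gt0//.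
  rewrite -(@ler_pXn2r _ 2) ?nnegrE ?mulr_ge0 ?addr_ge0// ?exprn_ge0//.
  rewrite exprMn real_normK ?num_real// -exprM mulnC exprM mulrC.
  rewrite (_ : 2 ^+ 2 = 4 :> R); last by ring.
  by apply: (le_trans (h k)); nra.
have -> : x_ = (fun n => x_ 0%N + series (telescope x_) n).
  by apply/funext => n; rewrite -eq_sum_telescope.
apply: is_cvgD; first exact: is_cvg_cst.
apply: normed_cvg.
apply: (@series_le_cvg _ _ (geometric (1 + M) 2^-1)) => //.
- by move=> n /=; exact: normr_ge0.
- by move=> n /=; rewrite mulr_ge0 ?addr_ge0 ?exprn_ge0.
- by apply: is_cvg_geometric_series; rewrite ger0_norm// invf_lt1 ?ltr1n.
Qed.

(** The sum of the 4^k (f_(k+1) - f_k)^2 has a finite integral, hence is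
    finite almost everywhere; where it is finite, the increments of f_k decay
    geometrically. *)
Lemma L2_fast_cauchy_ae (f_ : nat -> T -> R) :
  (forall n, measurable_fun setT (f_ n)) ->
  (forall k : nat, (4 ^+ k)%:E * sqint (f_ k.+1 \- f_ k)%R <=
     (1 / (2 ^ (k + 1))%:R)%:E)%E ->
  exists2 f : T -> R, measurable_fun setT f & {ae mu, forall x, f_ ^~ x @ \oo --> f x}.
Proof.
move=> mf bf.
pose s x := (\sum_(k <oo) (4 ^+ k * (f_ k.+1 x - f_ k x) ^+ 2)%:E)%E.
have t0 k x : (0 <= (4 ^+ k * (f_ k.+1 x - f_ k x) ^+ 2)%:E)%E.
  by rewrite lee_fin mulr_ge0 ?sqr_ge0 ?exprn_ge0.
have mt k : measurable_fun setT (fun x => (4 ^+ k * (f_ k.+1 x - f_ k x) ^+ 2)%:E).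
  apply/measurable_EFinP/measurable_funM => //.
  by apply: measurable_funX; exact: measurable_funB.
have ms : measurable_fun setT s by apply: ge0_emeasurable_sum => //.
have s0 x : (0 <= s x)%E by apply: nneseries_ge0.
have is_ : (\int[mu]_x s x < +oo)%E.
  rewrite integral_nneseries//.
  apply: (@le_lt_trans _ _ (\sum_(k <oo) (1 / (2 ^ (k + 1))%:R)%:E)%E).
    apply: lee_nneseries => [k _ _|k _]; first exact: integral_ge0.
    apply: le_trans (bf k).
    rewrite -ge0_integralZl_EFin ?exprn_ge0//.
    - by move=> x _; rewrite lee_fin sqr_ge0.
    - by apply/measurable_EFinP; apply: measurable_funX; exact: measurable_funB.
  by rewrite (cvg_lim _ (@cvg_geometric_eseries_half _ 1 0))// ltry.
have sfin : {ae mu, forall x, s x \is a fin_num}.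
  have : mu.-integrable setT s.
    apply/integrableP; split => //.
    by under eq_integral do rewrite gee0_abs//.
  move/(integrable_ae measurableT); apply: filterS => x; exact.
pose A := [set x | s x < +oo]%E.
have mA : measurable A by rewrite -[A]setTI; exact: emeasurable_fun_infty_o.
have cA x : A x -> cvgn (f_ ^~ x).
  move=> Ax; have : s x \is a fin_num by rewrite ge0_fin_numE.
  move=> sx; apply: (@fast_cauchy_cvg _ (fine (s x))) => k.
  rewrite -lee_fin fineK//.
  have := @nneseries_lim_ge _ (fun k => (4 ^+ k * (f_ k.+1 x - f_ k x) ^+ 2)%:E) xpredT 0%N k.+1 (fun k _ _ => t0 k x).
  by apply: le_trans; rewrite big_mkord big_ord_recr/= leeDr// sume_ge0.
have cfA x : (fun n => (f_ n \_ A) x) @ \oo --> limn (fun n => (f_ n \_ A) x).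
  have [Ax|Ax] := pselect (A x).
    have -> : (fun n => (f_ n \_ A) x) = f_ ^~ x.
      by apply/funext => n; rewrite patchE mem_set.
    exact: cA.
  have -> : (fun n => (f_ n \_ A) x) = (fun=> 0).
    by apply/funext => n; rewrite patchE memNset.
  exact: is_cvg_cst.
exists (fun x => limn (fun n => (f_ n \_ A) x)).
  apply: (@measurable_fun_cvg _ _ _ _ (fun n => f_ n \_ A)) => // n.
  by apply/(measurable_restrictT _ mA); exact: measurable_funS (mf n).
apply: filterS sfin => x sx; have Ax : A x by rewrite /A/= -ge0_fin_numE.
have -> : f_ ^~ x = (fun n => (f_ n \_ A) x).
  by apply/funext => n; rewrite patchE mem_set.
exact: cfA.
Qed.

End square_integrable.

(** If N is null, so are N x T and T x N. *)
Lemma ae_product d (T : measurableType d) (R : realType)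
    (m : {sigma_finite_measure set T -> \bar R}) (P : T -> Prop) :
  {ae m, forall x, P x} -> {ae (m \x m)%E, forall p : T * T, P p.1 /\ P p.2}.
Proof.
move=> [A [mA A0 PA]].
have a1 : {ae (m \x m)%E, forall p : T * T, P p.1}.
  exists (A `*` setT); split; first exact: measurableX.
    by rewrite product_measure1E// [X in (X * _)%E](_ : _ = 0%E) ?mul0e.
  by move=> p np; split => //; exact: PA.
have a2 : {ae (m \x m)%E, forall p : T * T, P p.2}.
  exists (setT `*` A); split; first exact: measurableX.
    by rewrite product_measure1E// [X in (_ * X)%E](_ : _ = 0%E) ?mule0.
  by move=> p np; split => //; exact: PA.
by apply: filterS2 a1 a2 => p.
Qed.

(** * Smooth functions *)

Section smooth.
Context {R : realType}.
Implicit Types (f g : R -> R) (p : {poly R}).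

Definition smooth f := forall n x, derivable (derive1n n f) x 1.

Lemma smooth_derive1 f : smooth f -> smooth (derive1 f).
Proof. by move=> sf n x; rewrite -derive1Sn. Qed.

Lemma smooth_is_derive f (x : R) : smooth f -> is_derive x (1 : R) f ((derive1 f) x).
Proof. by move=> sf; apply: DeriveDef; [exact: (sf 0%N)|rewrite derive1E]. Qed.

Lemma smooth_continuous f : smooth f -> continuous f.
Proof.
move=> sf x; apply/differentiable_continuous; rewrite -derivable1_diffP.
exact: (sf 0%N).
Qed.

(** A coinduction principle: a class of functions in which each member has a
    derivative consists of smooth functions. *)
Lemma smooth_coind (S : set (R -> R)) f : S f ->
  (forall g, S g -> exists2 g', S g' & forall x : R, is_derive x (1 : R) g (g' x)) ->
  smooth f.
Proof.
move=> Sf h n.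
suff Sn : S (derive1n n f) by move=> x; have [g' _ dg] := h _ Sn; have [] := dg x.
elim: n => [//|n IH]; rewrite derive1nS.
have [g' Sg' dg] := h _ IH.
have -> : derive1 (derive1n n f) = g' by apply/funext => x; rewrite derive1E derive_val.
exact: Sg'.
Qed.

Lemma smooth_lin (a : R) f g : smooth f -> smooth g -> smooth (a *: f + g).
Proof.
move=> sf sg.
apply: (@smooth_coind [set h | exists f g, [/\ smooth f, smooth g & h = a *: f + g]]).
  by exists f, g.
move=> _ [f1 [g1 [sf1 sg1 ->]]]; exists (a *: (derive1 f1) + (derive1 g1)).
  exists (derive1 f1), (derive1 g1).
  by split; [exact: smooth_derive1|exact: smooth_derive1|reflexivity].
move=> x; have := smooth_is_derive x sf1; have := smooth_is_derive x sg1 => ? ?.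
exact: is_deriveD.
Qed.

(** The derivative of a product of smooth functions is a sum of two such
    products, so it is the class of these sums that is stable. *)
Inductive product_sum : (R -> R) -> Prop :=
| product_sum_mul f g : smooth f -> smooth g -> product_sum (f * g)
| product_sum_add f g : product_sum f -> product_sum g -> product_sum (f + g).

Lemma smoothM f g : smooth f -> smooth g -> smooth (f * g).
Proof.
move=> sf sg; apply: (@smooth_coind product_sum); first exact: product_sum_mul.
move=> h; elim=> {f g sf sg h} [f g sf sg|f g _ [f' Sf' df] _ [g' Sg' dg]].
  exists (f * (derive1 g) + g * (derive1 f)).
    by apply: product_sum_add; apply: product_sum_mul;
      [exact: sf|exact: smooth_derive1|exact: sg|exact: smooth_derive1].
  move=> x; have := smooth_is_derive x sf; have := smooth_is_derive x sg => ? ?.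
  exact: is_deriveM.
exists (f' + g'); first exact: product_sum_add.
by move=> x; have := df x; have := dg x => ? ?; exact: is_deriveD.
Qed.

Lemma smooth_affine f (c d : R) : smooth f -> smooth (fun x => f (c * x + d)).
Proof.
move=> sf.
apply: (@smooth_coind
  [set h | exists k g, smooth g /\ h = fun x => k * g (c * x + d)]).
  by exists 1, f; split => //; apply/funext => x; rewrite mul1r.
move=> _ [k [g [sg ->]]]; exists (fun x => (k * c) * (derive1 g) (c * x + d)).
  by exists (k * c), (derive1 g); split; [exact: smooth_derive1|reflexivity].
move=> x; have := smooth_is_derive (c * x + d) sg => dg.
have da : is_derive x (1 : R) (fun x : R => c * x + d) c.
  have := @is_deriveD R R R (c \*o id) (cst d) x 1 c 0.
  rewrite addr0; apply.
  by apply: is_derive_eq; rewrite ?scaler1.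
have dgc := @is_derive1_comp _ g (fun x => c * x + d) x _ _ dg da.
rewrite -mulrA [c * _]mulrC.
exact: (@is_deriveZ _ _ _ _ k _ _ _ dgc).
Qed.

(** For p = 1 this is the classical function exp (-1/x), flat at 0. The
    factors p(1/x) make the family stable under differentiation. *)
Definition flat p (x : R) : R := if x <= 0 then 0 else p.[x^-1] * expR (- x^-1).

(** The exponential beats every power of 1/x; the exponent 2 gives
    differentiability at 0, with derivative 0. *)
Lemma flat_bound p : exists2 C, 0 <= C & forall x, `|x| <= 1 -> `|flat p x| <= C * x ^+ 2.
Proof.
pose n := size p; pose A : R := \sum_(i < n) `|p`_i|.
exists (A * (n.+2)`!%:R); first by rewrite mulr_ge0// sumr_ge0.
move=> x x1; rewrite /flat; case: ifPn => [_|].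
  by rewrite normr0 mulr_ge0 ?sqr_ge0// mulr_ge0 ?sumr_ge0.
rewrite -ltNge => x0; rewrite gtr0_norm// in x1.
pose y : R := x^-1; rewrite -/y; have y1 : 1 <= y by rewrite /y -[leLHS]invr1 lef_pV2 ?posrE.
have y0 : 0 < y by rewrite invr_gt0.
have pA : `|p.[y]| <= A * y ^+ n.
  rewrite horner_coef mulr_suml; apply: (le_trans (ler_norm_sum _ _ _)).
  apply: ler_sum => i _; rewrite normrM ler_wpM2l// ger0_norm ?exprn_ge0 ?(ltW y0)//.
  by rewrite (@ler_weXn2l _ y) ?(ltnW (ltn_ord i)).
have eA : expR (- y) <= (n.+2)`!%:R / y ^+ n.+2.
  rewrite expRN -[leRHS]invrK invf_div lef_pV2 ?posrE ?expR_gt0//; last first.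
    by rewrite divr_gt0 ?exprn_gt0// ltr0n fact_gt0.
  apply: (@le_trans _ _ (1 + y ^+ n.+2 / (n.+2)`!%:R)).
    by rewrite (lerDr (y ^+ n.+2 / (n.+2)`!%:R) 1).
  exact: (expR_ge1Dxn n.+1 (ltW y0)).
rewrite normrM (ger0_norm (expR_ge0 _)).
apply: (@le_trans _ _ (A * y ^+ n * ((n.+2)`!%:R / y ^+ n.+2))).
  by rewrite ler_pM ?expR_ge0.
have -> : x = y^-1 by rewrite /y invrK.
rewrite le_eqVlt; apply/orP; left; apply/eqP.
rewrite -addn2 exprD; field.
by rewrite gt_eqF//= expf_eq0 gt_eqF// andbF.
Qed.

Lemma is_derive_flat p (x : R) : is_derive x (1 : R) (flat p) (flat ('X^2 * (p - p^`())) x).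
Proof.
have [x0|x0|->] := ltgtP x 0.
- rewrite /flat (ltW x0).
  have h : is_derive x (1 : R) (cst 0 : R -> R) 0 by exact: is_derive_cst.
  apply: (near_eq_is_derive _ h).
  near=> z; rewrite ifT//; apply/ltW; near: z; exact: lt_nbhsl.
- rewrite {2}/flat leNgt x0/=.
  have h : is_derive x (1 : R) (fun z => p.[z^-1] * expR (- z^-1))
     (('X^2 * (p - p^`())).[x^-1] * expR (- x^-1)).
    have dV : is_derive x (1 : R) (fun z : R => z^-1) (- x ^- 2).
      have := @is_deriveV R id x 1 1 (lt0r_neq0 x0) (is_derive_id _ _).
      by rewrite scaler1.
    have d1 := @is_derive1_comp _ (horner p) _ x _ _ (is_derive_poly p x^-1) dV.
    have dNV := is_deriveN dV.
    have d2 := @is_derive1_comp _ (@expR R) _ x _ _ (is_derive_expR (- x^-1)) dNV.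
    apply: is_derive_eq (is_deriveM d1 d2) _.
    rewrite /GRing.scale/= !hornerE /=.
    rewrite exprVn; ring.
  apply: (near_eq_is_derive _ h).
  near=> z; rewrite /flat ifF//; apply/negbTE; rewrite -ltNge; near: z.
  exact: (@cvgr_gt _ _ _ _ id x cvg_id).
- have f0 q : flat q 0 = 0 by rewrite /flat lexx.
  rewrite f0; have [C C0 hC] := flat_bound p.
  have cv : h^-1 *: (flat p (h *: 1 + 0) - flat p 0) @[h --> 0^'] --> 0.
    apply/cvgr0Pnorm_lt => e e0; near=> h.
    have h0 : h != 0 by near: h; exact: nbhs_dnbhs_neq.
    have h1 : `|h| <= 1 by near: h; apply: dnbhs0_le.
    have he : `|h| < e / (C + 1).
      by near: h; apply: dnbhs0_lt; rewrite divr_gt0// ltr_wpDl.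
    rewrite addr0 f0 subr0 [h *: 1]mulr1 /GRing.scale/= normrM normfV.
    rewrite ltr_pdivrMl ?normr_gt0//.
    apply: (le_lt_trans (hC _ h1)).
    rewrite -(real_normK (num_real h)) expr2 mulrCA ltr_pM2l ?normr_gt0//.
    move: he; rewrite ltr_pdivlMr ?ltr_wpDl// mulrC; apply: le_lt_trans.
    by rewrite ler_wpM2r// lerDl.
  apply: DeriveDef; first by apply/cvg_ex; exists 0.
  exact/cvg_lim.
Unshelve. all: by end_near. Qed.

Lemma smooth_flat p : smooth (flat p).
Proof.
apply: (@smooth_coind [set flat p | p in setT]); first by exists p.
move=> _ [q _ <-]; exists (flat ('X^2 * (q - q^`()))); first by exists ('X^2 * (q - q^`())).
by move=> x; exact: is_derive_flat.
Qed.
End smooth.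

(** * Test functions *)

Section test_functions.
Context {R : realType}.
Implicit Types (D : set R) (f phi psi : R -> R) (a b : R).

Lemma open_itvcc_nbhs D c : open D -> D c ->
  exists2 e : R, 0 < e & `[c - e, c + e] `<=` D.
Proof.
move=> oD Dc; have /nbhs_ballP[e /= e0 eD] : nbhs c D by exact: open_nbhs_nbhs.
exists (e / 2); first by rewrite divr_gt0.
move=> x /=; rewrite in_itv/= => /andP[cx xc]; apply: eD.
rewrite /ball/= ltr_norml; apply/andP; split; lra.
Qed.

Definition supported_in (a b : R) phi := forall x, x <= a \/ b <= x -> phi x = 0.

Lemma near_eq0_derive1 f x : (\near x, f x = 0) -> derive1 f x = 0.
Proof.
by move=> h; rewrite derive1E (@near_eq_derive _ _ _ f (cst 0)) ?derive_cst.
Qed.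

(** A compact subset of an open interval fits with some room in a compact
    subinterval; the room makes the derivative vanish at the end points too. *)
Lemma test_function_supported D phi : open D -> is_interval D -> D !=set0 ->
  test_function D phi ->
  smooth phi /\ exists a b, [/\ a < b, `[a, b] `<=` D,
    supported_in a b phi & supported_in a b (derive1 phi)].
Proof.
move=> oD iD [c Dc] [sphi cK KD]; split => //.
set S := [set x | phi x != 0] in cK KD.
have [k1 [k2 [k12 Dk1 Dk2 out]]] : exists k1 k2,
    [/\ k1 <= k2, D k1, D k2 & forall x, x < k1 \/ k2 < x -> phi x = 0].
  have SK : S `<=` closure S by exact: subset_closure.
  have [K0|/set0P K0] := eqVneq (closure S) set0.
    exists c, c; split => // x _; apply/eqP; rewrite -[_ == _]negbK.
    by apply/negP => Sx; have := SK _ Sx; rewrite K0.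
  have cid : {within closure S, continuous (@id R)}.
    by apply: continuous_subspaceT => x; exact: cvg_id.
  have [k1 /set_mem Kk1 mink] := compact_EVT_min K0 cK cid.
  have [k2 /set_mem Kk2 maxk] := compact_EVT_max K0 cK cid.
  exists k1, k2; split; [by apply: mink; exact/mem_set|exact: KD|exact: KD|].
  move=> x xk; apply/eqP; rewrite -[_ == _]negbK; apply/negP => Sx.
  have := mink x (mem_set (SK _ Sx)); have := maxk x (mem_set (SK _ Sx)).
  by case: xk => /=; lra.
have [e1 e10 e1D] := open_itvcc_nbhs oD Dk1.
have [e2 e20 e2D] := open_itvcc_nbhs oD Dk2.
exists (k1 - e1), (k2 + e2); split; first lra.
- move=> x /=; rewrite in_itv/= => /andP[x1 x2].
  apply: (iD (k1 - e1) (k2 + e2)); last by apply/andP.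
    by apply: e1D; rewrite /= in_itv/=; apply/andP; split; lra.
  by apply: e2D; rewrite /= in_itv/=; apply/andP; split; lra.
- by move=> x xk; apply: out; case: xk => xk; [left|right]; lra.
- move=> x xk; apply: near_eq0_derive1; case: xk => xk.
    have : x < k1 by lra.
    by move/lt_nbhsl; apply: filterS => y yk; apply: out; left.
  have k2x : k2 < x by lra.
  have : \forall y \near x, k2 < y by exact: (@cvgr_gt _ _ _ _ id x cvg_id).
  by apply: filterS => y yk; apply: out; right.
Qed.

Lemma supported_test_function D phi a b : smooth phi ->
  `[a, b] `<=` D -> supported_in a b phi -> test_function D phi.
Proof.
move=> sphi abD sup.
have Kab : closure [set x | phi x != 0] `<=` `[a, b].
  rewrite [X in _ `<=` X](closure_id _).1; last exact: itv_closed.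
  apply: closure_subset => x /= px; rewrite in_itv/=.
  by apply/andP; split; rewrite leNgt; apply/negP => xa;
    move: px; rewrite sup ?eqxx//; [left|right]; exact: ltW.
split => //; last exact: subset_trans Kab abD.
apply: (subclosed_compact _ _ Kab); first exact: closed_closure.
exact: segment_compact.
Qed.

Lemma test_function_lin D (k : R) phi psi : open D -> is_interval D -> D !=set0 ->
  test_function D phi -> test_function D psi -> test_function D (k *: phi + psi).
Proof.
move=> oD iD D0 tphi tpsi.
have [sphi [a [b [ab abD supab _]]]] := test_function_supported oD iD D0 tphi.
have [spsi [c [d [cd cdD supcd _]]]] := test_function_supported oD iD D0 tpsi.
apply: (@supported_test_function D _ (Num.min a c) (Num.max b d)).
- exact: smooth_lin.
- move=> x /=; rewrite in_itv/= ge_min le_max => /andP[x1 x2].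
  have Da : D a by apply: abD; rewrite /= in_itv/= lexx ltW.
  have Db : D b by apply: abD; rewrite /= in_itv/= lexx ltW.
  have Dc : D c by apply: cdD; rewrite /= in_itv/= lexx ltW.
  have Dd : D d by apply: cdD; rewrite /= in_itv/= lexx ltW.
  case/orP: x1 => x1; case/orP: x2 => x2.
  + by apply: (iD a b) => //; rewrite x1.
  + by apply: (iD a d) => //; rewrite x1.
  + by apply: (iD c b) => //; rewrite x1.
  + by apply: (iD c d) => //; rewrite x1.
- move=> x; rewrite le_min ge_max => xacbd.
  have -> : (k *: phi + psi) x = k * phi x + psi x by [].
  by rewrite supab ?supcd ?mulr0 ?addr0//;
    case: xacbd => /andP[]; [left|right|left|right].
Qed.

(** The two factors vanish at the left of a and at the right of b, and tend to
    1 elsewhere: these are smooth approximations of the indicator of ]a, b[. *)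
Definition bump (n : nat) a b : R -> R :=
  (fun x => flat 1 (n%:R * x + - (n%:R * a))) *
  (fun x => flat 1 (- n%:R * x + n%:R * b)).

Lemma bumpE n a b x :
  bump n a b x = flat 1 (n%:R * (x - a)) * flat 1 (n%:R * (b - x)).
Proof.
rewrite -[LHS]/(flat 1 (n%:R * x + - (n%:R * a)) * flat 1 (- n%:R * x + n%:R * b)).
by congr (flat 1 _ * flat 1 _); ring.
Qed.

Lemma flat1_itv (x : R) : 0 <= flat 1 x <= 1.
Proof.
rewrite /flat; case: ifPn => [_|]; first by rewrite lexx ler01.
rewrite -ltNge => x0; rewrite hornerE mul1r expR_ge0 expR_le1.
by rewrite oppr_le0 invr_ge0 ltW.
Qed.

Lemma bump_itv n a b x : 0 <= bump n a b x <= 1.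
Proof.
rewrite bumpE; have := flat1_itv (n%:R * (x - a)); have := flat1_itv (n%:R * (b - x)).
move=> /andP[p0 p1] /andP[q0 q1]; rewrite mulr_ge0//=.
by rewrite -[leRHS]mulr1 ler_pM.
Qed.

Lemma smooth_bump n a b : smooth (bump n a b).
Proof. by apply: smoothM; apply: smooth_affine; exact: smooth_flat. Qed.

Lemma bump_supported n a b : supported_in a b (bump n a b).
Proof.
move=> x; rewrite bumpE => -[xa|xb].
- by rewrite {1}/flat ifT ?mul0r// mulr_ge0_le0// subr_le0.
- by rewrite {2}/flat ifT ?mulr0// mulr_ge0_le0// subr_le0.
Qed.

Lemma flat1_cvg (y : R) : 0 < y -> flat 1 (n%:R * y) @[n --> \oo] --> (1 : R).
Proof.
move=> y0.
have : expR (- ((n%:R * y)^-1)) @[n --> \oo] --> expR (0 : R).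
  apply: continuous_cvg; first exact: continuous_expR.
  rewrite -oppr0; apply: cvgN; rewrite -(mul0r y^-1).
  under eq_fun do rewrite invfM.
  apply: cvgM; last exact: cvg_cst.
  rewrite -cvg_shiftS; exact: cvg_harmonic.
rewrite expR0 => h; apply: cvg_trans h; apply: near_eq_cvg.
near=> n; rewrite /flat ifF ?hornerE ?mul1r//.
apply/negbTE; rewrite -ltNge mulr_gt0// ltr0n.
by near: n; exact: nbhs_infty_gt.
Unshelve. all: by end_near. Qed.

Lemma bump_cvg a b x : bump n a b x @[n --> \oo] --> (\1_(`]a, b[%classic) x : R).
Proof.
rewrite indicE; have [|xab] := boolP (x \in _).
  rewrite inE/= in_itv/= => /andP[ax xb].
  rewrite -[X in _ --> X](mulr1 1).
  rewrite (_ : (fun n => _) =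
    (fun n => flat 1 (n%:R * (x - a)) * flat 1 (n%:R * (b - x)))); last first.
    by apply/funext => n; rewrite bumpE.
  by apply: cvgM; apply: flat1_cvg; rewrite subr_gt0.
rewrite (_ : (fun n => _) = cst 0); first exact: cvg_cst.
apply/funext => n; rewrite bump_supported//.
move: xab; rewrite notin_setE/= in_itv/= => /negP; rewrite negb_and -!leNgt.
by case/orP; [left|right].
Qed.

End test_functions.

(** * Weak derivatives on the half line *)

Section weak_derivatives.
Context {R : realType}.
Implicit Types (D : set R) (f g u v phi psi : R -> R) (a b : R).
Local Notation mu := (@lebesgue_measure R).

Lemma smooth_measurable D phi : smooth phi -> measurable_fun D phi.
Proof.
move=> sphi; apply: measurable_funS (continuous_measurable_fun _) => //.
by move=> x; exact: (smooth_continuous sphi).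
Qed.

Lemma supported_bounded phi a b : continuous phi -> supported_in a b phi ->
  exists2 M : R, 0 <= M & forall x, `|phi x| <= M.
Proof.
move=> cphi sup.
have cw : {within `[a, b], continuous phi} by apply: continuous_subspaceT.
have /compact_bounded [M [_ hM]] :=
  continuous_compact cw (@segment_compact _ a b).
exists (Num.max 0 (M + 1)); first by rewrite le_max lexx.
move=> x; rewrite le_max; have [xab|] := boolP (x \in `[a, b]).
  apply/orP; right; apply: hM; first by rewrite ltrDl.
  by exists x.
rewrite in_itv/= negb_and -!ltNge => xab; rewrite sup ?normr0 ?lexx//.
by case/orP: xab => /ltW; [left|right].
Qed.

Lemma locally_integrable_itvcc D g a b : locally_integrable D g ->
  `[a, b] `<=` D -> mu.-integrable `[a, b] (EFin \o g).
Proof.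
move=> [mg oD ig] abD; apply/integrableP; split.
  apply/measurable_EFinP; apply: measurable_funS mg => //.
  exact: open_measurable.
by apply: ig => //; exact: segment_compact.
Qed.

Lemma integrable_supportedM D g phi a b : locally_integrable D g ->
  `[a, b] `<=` D -> continuous phi -> supported_in a b phi ->
  mu.-integrable D (EFin \o (fun x => g x * phi x)).
Proof.
move=> lg abD cphi sup; have oD : open D by case: lg.
have mD : measurable D by exact: open_measurable.
have [M M0 hM] := supported_bounded cphi sup.
have -> : EFin \o (fun x => g x * phi x) =
    ((EFin \o (g \_ `[a, b])) \* (EFin \o phi))%E.
  apply/funext => x /=; rewrite -EFinM patchE; case: ifPn => // xab.
  rewrite sup ?mulr0//; move: xab; rewrite notin_setE/= in_itv/= => /negP.
  by rewrite negb_and -!ltNge => /orP[] /ltW; [left|right].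
apply: integrableMl => //.
- apply: integrable_patch => //; exact: locally_integrable_itvcc lg abD.
- by apply: measurable_funS (continuous_measurable_fun cphi).
- exists M; split; first exact: num_real.
  by move=> N MN x _; apply: le_trans (hM x) _; exact: ltW.
Qed.

(** Dominated convergence along the bumps of ]a, b[. *)
Lemma Rintegral_itv_eq0 D g : locally_integrable D g ->
  (forall phi, test_function D phi -> \int[mu]_(x in D) (g x * phi x) = 0) ->
  forall a b, a < b -> `[a, b] `<=` D -> \int[mu]_(x in `]a, b[) g x = 0.
Proof.
move=> lg h a b ab abD; have oD : open D by case: lg.
have mD : measurable D by exact: open_measurable.
have abD' : `]a, b[ `<=` D.
  by apply: subset_trans abD; exact: subset_itv_oo_cc.
have mg : measurable_fun D g by case: lg.
pose f_ n x := (g x * bump n a b x)%:E.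
pose f x := ((g \_ `]a, b[) x)%:E.
have mf_ n : measurable_fun D (f_ n).
  apply/measurable_EFinP/measurable_funM => //.
  by apply: smooth_measurable; exact: smooth_bump.
have mf : measurable_fun D f.
  apply/measurable_EFinP; apply/measurable_restrict => //.
  by apply: measurable_funS mg => //; exact: subIsetl.
have [] := @dominated_convergence _ _ _ mu D mD f_ f
   (fun x => `|((g \_ `[a, b]) x)%:E|%E) mf_ mf.
- apply: aeW => x Dx; apply: cvg_EFin; first by apply: nearW => n.
  rewrite (_ : (g \_ `]a, b[) x = g x * \1_`]a, b[%classic x); last first.
    by rewrite patchE indicE; case: ifPn => _; rewrite ?mulr1 ?mulr0.
  by apply: cvgM; [exact: cvg_cst|exact: bump_cvg].
- apply: integrable_abse.
  apply: integrable_patch => //; exact: locally_integrable_itvcc lg abD.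
- apply: aeW => x n Dx; rewrite /f_ lee_fin patchE; case: ifPn => xab.
    have /andP[b0 b1] := bump_itv n a b x.
    by rewrite normrM (ger0_norm b0) ler_piMr.
  rewrite (bump_supported n) ?mulr0//.
  move: xab; rewrite notin_setE/= in_itv/= => /negP.
  by rewrite negb_and -!ltNge => /orP[] /ltW; [left|right].
move=> iF _ cF.
have f_0 n : (\int[mu]_(x in D) f_ n x = 0)%E.
  have tb : test_function D (bump n a b).
    apply: (@supported_test_function _ _ _ a b) => //; first exact: smooth_bump.
    exact: bump_supported.
  have := h _ tb; rewrite /Rintegral => h0.
  rewrite -[LHS]fineK; first by rewrite h0.
  apply: integrable_fin_num => //.
  apply: (@integrable_supportedM _ _ _ a b) => //.
    by apply: smooth_continuous; exact: smooth_bump.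
  exact: bump_supported.
have h0 : (\int[mu]_(x in D) f x = 0)%E.
  move: cF; rewrite (_ : (fun n => _) = cst 0%E); last by apply/funext.
  by move/cvg_lim => <-//; rewrite lim_cst.
have DabE : D `&` `]a, b[ = `]a, b[%classic by rewrite setIidr.
by rewrite -DabE Rintegral_mkcondr /Rintegral h0.
Qed.

(** A primitive of g is constant on ]a, b[, and g is almost everywhere its
    derivative by Lebesgue differentiation. *)
Lemma ae_eq0_itv D g a b : locally_integrable D g ->
  (forall phi, test_function D phi -> \int[mu]_(x in D) (g x * phi x) = 0) ->
  a < b -> `[a, b] `<=` D -> {ae mu, forall x, x \in `]a, b[ -> g x = 0}.
Proof.
move=> lg h ab abD.
have igab : mu.-integrable setT (EFin \o (g \_ `[a, b])).
  apply: integrable_patch => //; exact: locally_integrable_itvcc lg abD.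
have ig y : mu.-integrable `[a, y] (EFin \o (g \_ `[a, b])).
  by apply: integrableS igab.
have H := @FTC1 R (g \_ `[a, b]) (BLeft a) ig.
have {}H := H (open_integrable_locally openT igab).
apply: (@filterS _ _ (ae_filter_ringOfSetsType mu)) H => x /= Hx xab.
have xab' := xab; move: xab'; rewrite in_itv/= => /andP[ax xb].
have [_] := Hx ax; rewrite patchE mem_set; last first.
  by rewrite /= in_itv/= !ltW.
move=> <-; apply: near_eq0_derive1.
have := near_in_itvoo xab; apply: filterS => y.
rewrite in_itv/= => /andP[ay yb].
rewrite -[LHS]/(\int[mu]_(t in `[a, y]) (g \_ `[a, b]) t).
have ayab : `[a, y] `<=` `[a, b].
  by apply: subset_itvl; rewrite bnd_simp ltW.
have -> : \int[mu]_(t in `[a, y]) (g \_ `[a, b]) t = \int[mu]_(t in `[a, y]) g t.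
  by apply: eq_Rintegral => t /set_mem tay; rewrite patchE mem_set//; exact: ayab.
have iay : mu.-integrable `[a, y] (EFin \o g).
  exact: locally_integrable_itvcc lg (subset_trans ayab abD).
rewrite -Rintegral_itv_obnd_cbnd; last first.
  by apply: integrableS iay => //; exact: subset_itv_oc_cc.
rewrite -Rintegral_itv_bndo_bndc; last first.
  by apply: integrableS iay => //; exact: subset_itv_oo_cc.
by apply: (Rintegral_itv_eq0 lg h) => //; exact: subset_trans ayab abD.
Qed.

Lemma open_half_line : open (@half_line R).
Proof. exact: interval_open. Qed.

Lemma is_interval_half_line : is_interval (@half_line R).
Proof. exact: interval_is_interval. Qed.

Lemma half_lineE (x : R) : half_line x <-> 0 < x.
Proof. by rewrite /half_line/= in_itv/= andbT. Qed.

Lemma half_line_nonempty : @half_line R !=set0.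
Proof. by exists 1; apply/half_lineE. Qed.

(** The fundamental lemma of the calculus of variations; the intervals
    ]1/n, n[ exhaust the half line. *)
Lemma fundamental_lemma g : locally_integrable half_line g ->
  (forall phi, test_function half_line phi ->
     \int[mu]_(x in half_line) (g x * phi x) = 0) ->
  {ae mu, forall x, half_line x -> g x = 0}.
Proof.
move=> lg h.
have : {ae mu, forall x, forall n : nat,
    x \in `](n.+2%:R^-1 : R), n.+2%:R[ -> g x = 0}.
  apply: ae_foralln => n.
  have n1 : (n.+2%:R^-1 : R) < 1 by rewrite invf_lt1 ?ltr0n// ltr1n.
  have n2 : 1 < n.+2%:R :> R by rewrite ltr1n.
  apply: (ae_eq0_itv lg h); first exact: lt_trans n1 n2.
  move=> x /=; rewrite in_itv/= => /andP[x1 _]; apply/half_lineE.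
  by apply: lt_le_trans x1; rewrite invr_gt0.
apply: (@filterS _ _ (ae_filter_ringOfSetsType mu)) => x H /half_lineE x0.
pose n := Num.bound (x + x^-1).
have xn : x + x^-1 < n.+2%:R.
  apply: (@lt_trans _ _ n%:R); last by rewrite ltr_nat.
  by apply: archi_boundP; rewrite addr_ge0 ?invr_ge0// ltW.
have x1 : 0 < x^-1 by rewrite invr_gt0.
apply: (H n); rewrite in_itv/=; apply/andP; split; last lra.
by rewrite -[ltRHS]invrK ltf_pV2 ?posrE//; lra.
Qed.

Lemma smooth_locally_integrable D phi : open D -> smooth phi ->
  locally_integrable D phi.
Proof.
move=> oD sphi; split => //; first exact: smooth_measurable.
move=> K KD cK; have : mu.-integrable K (EFin \o phi).
  apply: continuous_compact_integrable => //.
  by apply: continuous_subspaceT; exact: smooth_continuous.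
by case/integrableP.
Qed.

Lemma smooth_derivable_oo phi a b : smooth phi -> derivable_oo_LRcontinuous phi a b.
Proof.
move=> sphi; split; first by move=> x _; exact: (sphi 0%N).
  by apply: cvg_at_right_filter; exact: smooth_continuous.
by apply: cvg_at_left_filter; exact: smooth_continuous.
Qed.

Lemma test_function_half_line phi : test_function half_line phi ->
  [/\ smooth phi, continuous phi, continuous (derive1 phi) & exists a b,
   [/\ 0 < a, a < b, `[a, b] `<=` half_line, supported_in a b phi &
     supported_in a b (derive1 phi)]].
Proof.
move=> tphi; have [sphi [a [b [ab abD sup sup']]]] := test_function_supported
  open_half_line is_interval_half_line half_line_nonempty tphi.
split => //; first exact: smooth_continuous.
  by apply: smooth_continuous; exact: smooth_derive1.
exists a, b; split => //; apply/half_lineE/abD.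
by rewrite /= in_itv/= lexx ltW.
Qed.

Lemma smooth_is_weak_derivative phi : smooth phi ->
  is_weak_derivative half_line phi (derive1 phi).
Proof.
move=> sphi; have sphi' := smooth_derive1 sphi; split.
- exact: smooth_locally_integrable open_half_line sphi.
- exact: smooth_locally_integrable open_half_line sphi'.
move=> psi /test_function_half_line[spsi _ _ [a [b [_ ab abD sup sup']]]].
have spsi' := smooth_derive1 spsi.
have toab (F : R -> R) : supported_in a b F ->
    \int[mu]_(x in half_line) F x = \int[mu]_(x in `[a, b]) F x.
  move=> supF; rewrite -[in RHS](setIidr abD) Rintegral_mkcondr.
  apply: eq_Rintegral => x _; rewrite patchE; case: ifPn => //.
  rewrite notin_setE/= in_itv/= => /negP; rewrite negb_and -!ltNge => xab.
  by apply: supF; case/orP: xab => /ltW; [left|right].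
rewrite !toab; last 2 first.
- by move=> x xab; rewrite sup ?mulr0.
- by move=> x xab; rewrite sup' ?mulr0.
rewrite (@Rintegration_by_parts _ phi psi (derive1 phi) (derive1 psi))//.
- by rewrite !sup ?mulr0 ?subrr ?sub0r//; [left|right].
- by apply: continuous_subspaceT; exact: smooth_continuous.
- exact: smooth_derivable_oo.
- by apply: continuous_subspaceT; exact: smooth_continuous.
- exact: smooth_derivable_oo.
Qed.

Lemma weak_derivativeP D u : weakly_differentiable D u ->
  is_weak_derivative D u (weak_derivative D u).
Proof. exact: xgetPex. Qed.

Lemma locally_integrable_lin (k : R) f g : locally_integrable half_line f ->
  locally_integrable half_line g -> locally_integrable half_line (k *: f + g).
Proof.
move=> lf lg; apply: locally_integrableD => //.
have mD : measurable (half_line : set (measurableTypeR R)).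
  exact: open_measurable open_half_line.
case: lf => mf oD ifin; split => //; first exact: measurable_funM.
move=> K KD cK.
suff : mu.-integrable K (EFin \o (fun x => k * f x)) by case/integrableP.
have mK : measurable K by exact: compact_measurable.
under [X in mu.-integrable _ X]eq_fun do rewrite /= EFinM.
apply: integrableZl => //; apply/integrableP; split; last exact: ifin.
by apply/measurable_EFinP; apply: measurable_funS mf.
Qed.

Lemma is_weak_derivative_lin (k : R) u v f g : is_weak_derivative half_line u f ->
  is_weak_derivative half_line v g ->
  is_weak_derivative half_line (k *: u + v) (k *: f + g).
Proof.
move=> [lu lf uf] [lv lg vg]; split; try exact: locally_integrable_lin.
move=> phi tphi.
have [sphi cphi cphi' [a [b [a0 ab abD sup sup']]]] := test_function_half_line tphi.
have mD : measurable (half_line : set (measurableTypeR R)).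
  exact: open_measurable open_half_line.
have iM h psi : locally_integrable half_line h -> continuous psi ->
    supported_in a b psi ->
    mu.-integrable half_line (EFin \o (fun x => h x * psi x)).
  by move=> lh cp sp; exact: (integrable_supportedM lh abD cp sp).
have split_ w h psi : locally_integrable half_line w ->
    locally_integrable half_line h -> continuous psi -> supported_in a b psi ->
    \int[mu]_(x in half_line) ((k *: w + h) x * psi x) =
    k * \int[mu]_(x in half_line) (w x * psi x) +
    \int[mu]_(x in half_line) (h x * psi x).
  move=> lw lh cp sp; rewrite -RintegralZl//; last exact: iM.
  rewrite -RintegralD//; [|exact: integrableZl (iM _ _ _ _ _)|exact: iM].
  by apply: eq_Rintegral => x _; rewrite [(k *: w + h) x]/(k * w x + h x) mulrDl mulrA.
by rewrite !split_// uf// vg// opprD mulrN.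
Qed.

Lemma weak_derivative_unique u f g : is_weak_derivative half_line u f ->
  is_weak_derivative half_line u g -> {ae mu, forall x, half_line x -> f x = g x}.
Proof.
move=> uf ug; have [_ lf _] := uf; have [_ lg _] := ug.
have [_ lfg fg] := is_weak_derivative_lin (-1) uf ug.
have : {ae mu, forall x, half_line x -> (- 1 *: f + g) x = 0}.
  apply: fundamental_lemma => // phi tphi; apply: oppr_inj.
  have u0 : -1 *: u + u = cst 0 by rewrite scaleN1r addNr.
  rewrite -fg// oppr0 /Rintegral (_ : (fun x => _) = cst 0%E) ?integral0//.
  by apply/funext => x; rewrite u0 mul0r.
apply: (@filterS _ _ (ae_filter_ringOfSetsType mu)) => x h /h fgx.
by have : -1 * f x + g x = 0 by []; lra.
Qed.

(** [weak_derivative] is an arbitrary choice, which can only be computed up to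
    a null set. *)
Lemma weak_derivative_ae u g : is_weak_derivative half_line u g ->
  {ae mu, forall x, half_line x -> weak_derivative half_line u x = g x}.
Proof.
move=> ug; apply: (weak_derivative_unique (weak_derivativeP _) ug).
by exists g.
Qed.

End weak_derivatives.

(** * Monotone functions and affine changes of variable *)

Section monotone_measurable.
Context {R : realType}.
Local Notation mu := (@lebesgue_measure R).

Lemma nonincreasing_in_measurable (D : set R) (f : R -> R) : is_interval D ->
  (forall x y, D x -> D y -> x <= y -> f y <= f x) -> measurable_fun D f.
Proof.
move=> iD f_ni; apply: (measurability (@RGenCInfty.G R)) => [|/= _ [_] [r] -> <-].
  exact: RGenCInfty.measurableE.
apply: is_interval_measurable => s t /=.
rewrite !in_itv/= !andbT => -[Ds fs] [Dt ft] u /andP[su ut].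
have Du : D u by apply: (iD s t) => //; rewrite su.
by split => //; rewrite in_itv/= andbT (le_trans ft)// f_ni.
Qed.

Lemma nondecreasing_in_measurable (D : set R) (f : R -> R) : is_interval D ->
  (forall x y, D x -> D y -> x <= y -> f x <= f y) -> measurable_fun D f.
Proof.
move=> iD f_nd; rewrite -(opprK f); apply: measurable_funN.
by apply: nonincreasing_in_measurable => // x y Dx Dy xy; rewrite lerN2; exact: f_nd.
Qed.

(** The image of the measure under x |-> a x + b, multiplied by a, gives every
    interval its length, so it is the Lebesgue measure. *)
Lemma ge0_integral_affine (f : R -> R) (a b : R) : 0 < a ->
  (forall x, 0 <= f x) -> measurable_fun setT f ->
  (\int[mu]_x (f x)%:E = a%:E * \int[mu]_x (f (a * x + b))%:E)%E.
Proof.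
move=> a0 f0 mf.
pose phi (x : measurableTypeR R) : measurableTypeR R := a * x + b.
have mphi : measurable_fun setT phi.
  by apply: measurable_funD => //; exact: measurable_funM.
pose nu := mscale (NngNum (ltW a0)) (pushforward mu phi).
have muE A : measurable A -> mu A = nu mphi A.
  apply: lebesgue_measure_unique => _ [[u v] uv <-] /=.
  rewrite /nu /= /mscale/= /pushforward.
  have -> : phi @^-1` `]u, v] = `](u - b) / a, (v - b) / a]%classic.
    apply/seteqP; split => x /=; rewrite !in_itv/= /phi => /andP[h1 h2].
      by rewrite ltr_pdivrMr// ler_pdivlMr//; apply/andP; split; lra.
    by move: h1 h2; rewrite ltr_pdivrMr// ler_pdivlMr// => h1 h2; apply/andP; split; lra.
  rewrite !lebesgue_measure_itv/= !lte_fin ltr_pM2r ?invr_gt0// ltrD2r.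
  case: ifPn => _; last by rewrite mule0.
  rewrite -!EFinD -EFinM; congr EFin; field; exact: lt0r_neq0.
transitivity (\int[nu mphi]_x (f x)%:E)%E.
  by apply: eq_measure_integral => A mA _; exact: muE.
rewrite ge0_integral_mscale//=; first by congr (_ * _)%E;
  rewrite ge0_integral_pushforward//; first exact/measurable_EFinP; move=> x _; rewrite lee_fin.
  exact/measurable_EFinP.
by move=> x _; rewrite lee_fin.
Qed.

End monotone_measurable.

(** * The kernel and the weight *)

Section kernel.
Context {R : realType} (gamma : R -> R) (delta : R).
Context (hgamma : admissible_kernel gamma) (delta0 : 0 < delta).
Local Notation mu := (@lebesgue_measure R).
Local Notation gd := (gamma_delta gamma delta).
Local Notation om := (omega_delta gamma delta).

Lemma gamma_norm_measurable : measurable_fun setT (fun s : R => gamma `|s|).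
Proof.
case: hgamma => g0 g_ni g1 _.
have m01 : measurable_fun (`]0, 1[ : set R) gamma.
  apply: nonincreasing_in_measurable; first exact: interval_is_interval.
  move=> x y /=; rewrite !in_itv/= => /andP[x0 x1] /andP[y0 y1] xy.
  exact: g_ni.
(* Monotonicity gives measurability on ]0, 1[, and gamma vanishes beyond 1;
   the values at 0 and 1 are added separately. *)
pose g01 := gamma \_ (`]0, 1[ : set R).
have mg01 : measurable_fun setT g01 by apply/(measurable_restrictT _ _).1.
rewrite (_ : (fun s => _) = (fun s => g01 `|s| + gamma 0 * \1_[set 0] `|s| +
    gamma 1 * \1_[set 1] `|s|)); last first.
  apply/funext => s; rewrite /g01 patchE !indicE.
  have := normr_ge0 s; move: `|s| => r r0.
  have -> : (r \in `]0, 1[%classic) = (0 < r < 1).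
    by apply/idP/idP => [/set_mem|h]; [|apply/mem_set]; rewrite /= in_itv.
  have -> : (r \in [set 0]) = (r == 0) by apply/idP/eqP => [/set_mem|/mem_set].
  have -> : (r \in [set 1]) = (r == 1) by apply/idP/eqP => [/set_mem|/mem_set].
  move: r0; rewrite le_eqVlt => /orP[/eqP <-|r0].
    by rewrite ltxx/= eqxx eq_sym oner_eq0 mulr1 mulr0 addr0 add0r.
  rewrite r0 (gt_eqF r0) mulr0 addr0.
  have [r1|r1|->] := ltgtP r 1; rewrite ?mulr0 ?mulr1 ?addr0 ?add0r//.
  exact: g1.
have mn : measurable_fun setT (fun s : R => `|s|) by exact: normr_measurable.
apply: measurable_funD; first apply: measurable_funD.
- exact: measurableT_comp.
- by apply: measurable_funM => //; apply: measurableT_comp => //; exact: measurable_indic.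
- by apply: measurable_funM => //; apply: measurableT_comp => //; exact: measurable_indic.
Qed.

Lemma gamma_deltaE s : gd s = delta ^- 3 * gamma `|s / delta|.
Proof. by rewrite /gamma_delta normrM normfV (gtr0_norm delta0). Qed.

Lemma gamma_delta_measurable : measurable_fun setT gd.
Proof.
rewrite (_ : gamma_delta _ _ = fun s => delta ^- 3 * gamma `|s / delta|); last first.
  by apply/funext => s; exact: gamma_deltaE.
apply: measurable_funM => //.
apply: (measurableT_comp gamma_norm_measurable).
exact: measurable_funM.
Qed.

Lemma gamma_delta_ge0 s : 0 <= gd s.
Proof.
rewrite gamma_deltaE mulr_ge0//; first by rewrite invr_ge0 exprn_ge0// ltW.
by case: hgamma => + _ _ _; apply.
Qed.

Lemma gamma_delta_norm s : gd `|s| = gd s.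
Proof. by rewrite /gamma_delta normr_id. Qed.

(** The integrand of the weight. It has mass 1 for every delta, which is what
    the factor delta^-3 in [gamma_delta] is for. *)
Definition moment_density s : R := `|s| ^+ 2 * gd s.
Local Notation k2 := moment_density.

Lemma moment_density_ge0 s : 0 <= k2 s.
Proof. by rewrite mulr_ge0 ?sqr_ge0 ?gamma_delta_ge0. Qed.

Lemma moment_density_measurable : measurable_fun setT k2.
Proof.
apply: measurable_funM; last exact: gamma_delta_measurable.
by apply: measurable_funX.
Qed.

Lemma moment_density_integral : (\int[mu]_s (k2 s)%:E = 1)%E.
Proof.
rewrite (ge0_integral_affine 0 delta0)//; last 2 first.
- exact: moment_density_ge0.
- exact: moment_density_measurable.
case: hgamma => _ _ _ h.
rewrite -[RHS]h -ge0_integralZl_EFin//; last 3 first.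
- by move=> x _; rewrite lee_fin moment_density_ge0.
- apply/measurable_EFinP; apply: (measurableT_comp moment_density_measurable).
  by apply: measurable_funD => //; exact: measurable_funM.
- exact: ltW.
apply: eq_integral => s _; rewrite -EFinM /moment_density gamma_deltaE addr0.
rewrite [delta * s]mulrC mulfK ?lt0r_neq0// normrM (gtr0_norm delta0).
by congr EFin; field; rewrite lt0r_neq0.
Qed.

Lemma moment_density_integrable : mu.-integrable setT (EFin \o k2).
Proof.
apply/integrableP; split; first by apply/measurable_EFinP; exact: moment_density_measurable.
rewrite (_ : (\int[mu]_x _)%E = 1%E) ?ltry// -moment_density_integral.
by apply: eq_integral => x _; rewrite /= ger0_norm// moment_density_ge0.
Qed.

(** By monotonicity it is enough that gamma is positive at one point of
    ]0, 1[; otherwise its second moment would be 0 instead of 1. *)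
Lemma gamma_delta_bounded_below :
  exists c rho : R, [/\ 0 < c, 0 < rho &
    forall s, 0 < `|s| -> `|s| < rho -> c <= gd s].
Proof.
case: (hgamma) => g0 g_ni g1 h.
have [r0 [r00 r01 gr0]] : exists r : R, [/\ 0 < r, r < 1 & 0 < gamma r].
  apply: contrapT => H.
  have H' r : 0 < r -> r < 1 -> gamma r = 0.
    move=> r0 r1; apply/eqP; rewrite eq_le (g0 _ (ltW r0)) andbT leNgt; apply/negP => gr.
    by apply: H; exists r.
  suff : (\int[mu]_s (`|s| ^+ 2 * gamma `|s|)%:E = 0)%E.
    by rewrite h => /eqP; rewrite onee_eq0.
  rewrite (ae_eq_integral (cst 0%E))// ?integral0//.
    apply/measurable_EFinP/measurable_funM; last exact: gamma_norm_measurable.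
    exact: measurable_funX.
  exists [set -1; 1]; split => //.
  - by apply: measurableU; exact: measurable_set1.
  - apply/eqP; rewrite eq_le measure_ge0 andbT.
    apply: (le_trans (measureU2 _ _ _)); [exact: measurable_set1..|].
    rewrite [leLHS](_ : _ = 0%E)// -[RHS](adde0 0%E).
    by congr (_ + _)%E; exact: lebesgue_measure_set1.
  move=> s /= /not_implyP[_ ns]; apply: contrapT => s1; apply: ns.
  have [->|s0] := eqVneq s 0; first by rewrite normr0 expr0n/= mul0r.
  have n0 : 0 < `|s| by rewrite normr_gt0.
  have [n1|n1|n1] := ltgtP `|s| 1; first by rewrite H' ?mulr0.
    by rewrite g1 ?mulr0.
  exfalso; apply: s1; have [sp|sn] := leP 0 (s : R).
    by right; rewrite -(ger0_norm sp).
  by left; rewrite -n1 (ltr0_norm sn) opprK.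
exists (delta ^- 3 * gamma r0), (delta * r0); split.
- by rewrite mulr_gt0// invr_gt0 exprn_gt0.
- exact: mulr_gt0.
move=> s s0 sr; rewrite gamma_deltaE ler_wpM2l//.
  by rewrite invr_ge0 exprn_ge0// ltW.
have dV : 0 < delta^-1 by rewrite invr_gt0.
rewrite normrM (gtr0_norm dV); apply: g_ni => //.
- by rewrite mulr_gt0.
- by rewrite ler_pdivrMr// mulrC ltW.
Qed.

Definition moment_below (r : R) : R := \int[mu]_(s in [set s | `|s| < r]) k2 s.

Lemma norm_lt_measurable (r : R) :
  measurable ([set s | `|s| < r] : set (measurableTypeR R)).
Proof.
rewrite (_ : [set s | `|s| < r] = `]- r, r[%classic)//.
by apply/seteqP; split => x /=; rewrite in_itv/= ltr_norml.
Qed.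

Lemma moment_below_integrable (r : R) : mu.-integrable [set s | `|s| < r] (EFin \o k2).
Proof.
apply: integrableS moment_density_integrable => //; exact: norm_lt_measurable.
Qed.

Lemma moment_belowE (r : R) :
  (\int[mu]_(s in [set s | (`|s| < r)%R]) (k2 s)%:E = (moment_below r)%:E)%E.
Proof.
by rewrite fineK//; apply: integrable_fin_num; [exact: norm_lt_measurable|
  exact: moment_below_integrable].
Qed.

Lemma moment_below_itv r : 0 <= moment_below r <= 1.
Proof.
apply/andP; split; first by apply: Rintegral_ge0 => s _; exact: moment_density_ge0.
rewrite -lee_fin -moment_belowE -moment_density_integral.
apply: ge0_subset_integral => //; first exact: norm_lt_measurable.
  by apply/measurable_EFinP; exact: moment_density_measurable.
by move=> s _; rewrite lee_fin moment_density_ge0.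
Qed.

Lemma moment_below_homo r s : r <= s -> moment_below r <= moment_below s.
Proof.
move=> rs; rewrite -lee_fin -!moment_belowE.
apply: ge0_subset_integral => //; try exact: norm_lt_measurable.
- apply/measurable_EFinP.
  by apply: measurable_funS moment_density_measurable.
- by move=> t _; rewrite lee_fin moment_density_ge0.
- by move=> t /= tr; exact: lt_le_trans rs.
Qed.

Lemma moment_below_gt0 (r : R) : 0 < r -> 0 < moment_below r.
Proof.
move=> r0; have [c [rho [c0 rho0 hc]]] := gamma_delta_bounded_below.
pose m : R := Num.min r rho.
have m0 : 0 < m by rewrite lt_min r0.
have mr : m <= r by rewrite ge_min lexx.
have mrho : m <= rho by rewrite ge_min lexx orbT.
pose h : R := m / 2; have hE : h = m / 2 by [].
have h0 : 0 < h by rewrite divr_gt0.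
(* On ]m/2, m[ the density is at least c h^2, and this interval has length h. *)
suff : ((c * h ^+ 2 * h)%:E <= (moment_below r)%:E)%E.
  by rewrite lee_fin; apply: lt_le_trans; rewrite !mulr_gt0 ?exprn_gt0.
rewrite -moment_belowE.
have sub : (\int[mu]_(s in `]h, m[) (k2 s)%:E <=
    \int[mu]_(s in [set s | (`|s| < r)%R]) (k2 s)%:E)%E.
  apply: ge0_subset_integral => //; first exact: norm_lt_measurable.
  - apply/measurable_EFinP.
    by apply: measurable_funS moment_density_measurable => //; exact: norm_lt_measurable.
  - by move=> t _; rewrite lee_fin moment_density_ge0.
  - by move=> s /=; rewrite in_itv/= => /andP[s1 s2]; rewrite gtr0_norm; lra.
apply: le_trans sub.
have -> : (c * h ^+ 2 * h)%:E =
    (\int[mu]_(s in `]h, m[) (c * h ^+ 2)%:E)%E.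
  rewrite integral_cst//= lebesgue_measure_itv/= lte_fin ifT; last by lra.
  by rewrite -EFinD -EFinM; congr (_ * _)%:E; lra.
apply: ge0_le_integral => //.
- by move=> s _; rewrite lee_fin mulr_ge0 ?sqr_ge0 ?ltW.
- apply/measurable_EFinP.
  by apply: measurable_funS moment_density_measurable.
- move=> s /=; rewrite in_itv/= => /andP[s1 s2].
  have s0 : 0 < s by lra.
  rewrite lee_fin /moment_density mulrC (gtr0_norm s0) ler_pM ?sqr_ge0 ?(ltW c0)//.
    by rewrite lerXn2r ?nnegrE ?(ltW h0) ?(ltW s0) ?(ltW s1).
  by rewrite -gamma_delta_norm; have := hc s; rewrite gtr0_norm//; apply => //; lra.
Qed.

Lemma omega_integrable x : 0 < x ->
  mu.-integrable `]0, 1[ (EFin \o (fun t => moment_below (x / t))).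
Proof.
move=> x0; apply: measurable_bounded_integrable => //.
- by rewrite /= lebesgue_measure_itv/= lte_fin ltr01 oppr0 adde0 ltry.
- apply: nonincreasing_in_measurable; first exact: interval_is_interval.
  move=> s t /=; rewrite !in_itv/= => /andP[s0 _] /andP[t0 _] st.
  by apply: moment_below_homo; rewrite ler_pM2l// lef_pV2.
- exists 1; split => // M M1 t _; have /andP[h0 h1] := moment_below_itv (x / t).
  by rewrite /= ger0_norm// (le_trans h1)// ltW.
Qed.

Lemma omegaE x : om x = \int[mu]_(t in `]0, 1[) moment_below (x / t).
Proof. by []. Qed.

(** The weight at x averages the moments below x / t, and x / t >= x. *)
Lemma omega_itv x : 0 < x -> moment_below x <= om x <= 1.
Proof.
move=> x0; rewrite omegaE.
have cstE (c : R) : c = \int[mu]_(t in `]0, 1[) c.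
  by rewrite Rintegral_cst//= lebesgue_measure_itv/= lte_fin ltr01 oppr0 adde0 mulr1.
have ic (c : R) : mu.-integrable `]0, 1[ (EFin \o (fun=> c)).
  apply: measurable_bounded_integrable => //.
    by rewrite /= lebesgue_measure_itv/= lte_fin ltr01 oppr0 adde0 ltry.
  by exists `|c|; split => // M M1 t _; exact: ltW.
apply/andP; split.
  rewrite [leLHS]cstE; apply: le_Rintegral => //; first exact: omega_integrable.
  move=> t /=; rewrite in_itv/= => /andP[t0 t1]; apply: moment_below_homo.
  by rewrite ler_pdivlMr// ler_piMr// ltW.
rewrite [leRHS](cstE 1); apply: le_Rintegral => //; first exact: omega_integrable.
by move=> t _; have /andP[] := moment_below_itv (x / t).
Qed.

Lemma omega_homo x y : 0 < x -> x <= y -> om x <= om y.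
Proof.
move=> x0 xy; rewrite !omegaE; apply: le_Rintegral => //; try exact: omega_integrable.
  by apply: omega_integrable; exact: lt_le_trans xy.
move=> t /=; rewrite in_itv/= => /andP[t0 t1]; apply: moment_below_homo.
by rewrite ler_pM2r// invr_gt0.
Qed.

Lemma omega_gt0 x : 0 < x -> 0 < om x.
Proof.
by move=> x0; have /andP[+ _] := omega_itv x0; apply: lt_le_trans; exact: moment_below_gt0.
Qed.

Lemma omega_le1 x : 0 < x -> om x <= 1.
Proof. by move=> /omega_itv/andP[]. Qed.

Lemma omega_measurable : measurable_fun half_line om.
Proof.
apply: nondecreasing_in_measurable; first exact: is_interval_half_line.
by move=> x y /half_lineE x0 _; exact: omega_homo.
Qed.

End kernel.

(** * Functions of finite energy *)

Section finite_energy.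
Context {R : realType} (gamma : R -> R) (delta : R).
Context (hgamma : admissible_kernel gamma) (delta0 : 0 < delta).
Implicit Types (u v g h : R -> R).
Local Notation mu := (@lebesgue_measure R).
Local Notation mu2 := (mu \x mu)%E.
Local Notation gd := (gamma_delta gamma delta).
Local Notation om := (omega_delta gamma delta).
Local Notation wd := (weak_derivative half_line).
Local Notation dom := (Omega `|` Omega_delta delta).

Definition nonlocal_region : set (R * R) := [set p | p.1 <= 0 \/ p.2 <= 0].

(** With the square roots of the kernel and of the weight inside, the energy is
    a sum of two L2 inner products ([b_qnlE]). *)
Definition nonlocal_part u : R * R -> R :=
  (fun p => Num.sqrt (gd (p.2 - p.1)) * (u p.2 - u p.1)) \_ nonlocal_region.

Definition local_part g : R -> R :=
  (fun x => Num.sqrt (om x) * g x) \_ half_line.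

Local Notation nl := nonlocal_part.
Local Notation lc := local_part.

Lemma half_line_measurable : measurable (half_line : set (measurableTypeR R)).
Proof. exact: open_measurable open_half_line. Qed.

Lemma nonlocal_region_measurable :
  measurable (nonlocal_region : set (measurableTypeR R * measurableTypeR R)).
Proof.
rewrite (_ : nonlocal_region = fst @^-1` `]-oo, 0] `|` snd @^-1` `]-oo, 0]).
  by apply: measurableU; rewrite -[X in measurable X]setTI;
    [exact: measurable_fst|exact: measurable_snd].
by apply/seteqP; split => p /=; rewrite !in_itv.
Qed.

Lemma nonlocal_part_measurable u : measurable_fun setT u ->
  measurable_fun (setT : set (measurableTypeR R * measurableTypeR R)) (nl u).
Proof.
move=> mf; apply/(measurable_restrictT _ nonlocal_region_measurable).
apply: (@measurable_funS _ _ _ _ setT) => //.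
have m1 : measurable_fun setT (fst : measurableTypeR R * measurableTypeR R -> measurableTypeR R).
  exact: measurable_fst.
have m2 : measurable_fun setT (snd : measurableTypeR R * measurableTypeR R -> measurableTypeR R).
  exact: measurable_snd.
apply: measurable_funM; last first.
  by apply: measurable_funB; [exact: (measurableT_comp mf m2)|exact: (measurableT_comp mf m1)].
apply: (measurableT_comp (@measurable_sqrt R)) => //.
apply: (measurableT_comp (gamma_delta_measurable hgamma delta0)).
exact: measurable_funB.
Qed.

Lemma local_part_measurable g : measurable_fun half_line g ->
  measurable_fun (setT : set (measurableTypeR R)) (lc g).
Proof.
move=> mg; apply/(measurable_restrictT _ half_line_measurable).
apply: measurable_funM => //.
apply: (measurableT_comp (@measurable_sqrt R)) => //.
exact: omega_measurable.
Qed.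

Lemma nonlocal_part_lin (a : R) u v : nl (a *: u + v) = a *: nl u + nl v.
Proof.
apply/funext => p; rewrite [RHS]fct_linE /nl !patchE.
case: ifPn => _; last by rewrite mulr0 addr0.
by rewrite !fct_linE; ring.
Qed.

Lemma local_part_lin (a : R) g h : lc (a *: g + h) = a *: lc g + lc h.
Proof.
apply/funext => x; rewrite [RHS]fct_linE /lc !patchE.
case: ifPn => _; last by rewrite mulr0 addr0.
by rewrite !fct_linE; ring.
Qed.

Lemma local_part_ae g h : {ae mu, forall x, half_line x -> g x = h x} ->
  {ae mu, forall x, lc g x = lc h x}.
Proof.
apply: (@filterS _ _ (ae_filter_ringOfSetsType mu)) => x gh.
by rewrite /lc !patchE; case: ifPn => // /set_mem /gh ->.
Qed.

Lemma omega_ge0 x : half_line x -> 0 <= om x.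
Proof. by move=> /half_lineE x0; apply/ltW; exact: omega_gt0. Qed.

Lemma b_qnlE u v : b_qnl gamma delta u v =
  (\int[mu2]_p (nl u p * nl v p)%:E + \int[mu]_x (lc (wd u) x * lc (wd v) x)%:E)%E.
Proof.
rewrite /b_qnl; congr (_ + _)%E.
  rewrite integral_mkcond; apply: eq_integral => p _.
  rewrite /nl !patchE -/nonlocal_region; case: ifPn => _; last by rewrite mul0r.
  rewrite gamma_delta_norm; congr EFin.
  rewrite -{1}(sqr_sqrtr (gamma_delta_ge0 hgamma delta0 _)); ring.
rewrite integral_mkcond; apply: eq_integral => x _.
rewrite /lc !patchE; case: ifPn => [/set_mem xh|_]; last by rewrite mul0r.
by congr EFin; rewrite -{1}(sqr_sqrtr (omega_ge0 xh)); ring.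
Qed.

(** The set on which the form is finite. It is defined without approximating
    sequences, so that algebraic facts are proved there and then restricted to
    [energy_space]. *)
Definition finite_energy : set (R -> R) :=
  [set u | [/\ forall x, ~ dom x -> u x = 0, L2set mu u, L2set mu2 (nl u),
    weakly_differentiable half_line u & L2set mu (lc (wd u))]].

Definition nonlocal_form u v : R := L2ip mu2 (nl u) (nl v).

Definition local_form u v : R := L2ip mu (lc (wd u)) (lc (wd v)).

Definition energy u v : R := nonlocal_form u v + local_form u v.

Definition energy_sobolev u v : R := L2ip mu u v + energy u v.

Lemma weak_derivative_measurable u : weakly_differentiable half_line u ->
  measurable_fun half_line (wd u).
Proof. by move=> /weak_derivativeP[_ []]. Qed.

Lemma weakly_differentiable_lin (a : R) u v : weakly_differentiable half_line u ->
  weakly_differentiable half_line v -> weakly_differentiable half_line (a *: u + v).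
Proof. by move=> [f uf] [g vg]; exists (a *: f + g); exact: is_weak_derivative_lin. Qed.

(** Additivity of the chosen weak derivatives, only almost everywhere. *)
Lemma local_weak_derivative_lin (a : R) u v : weakly_differentiable half_line u ->
  weakly_differentiable half_line v ->
  {ae mu, forall x, lc (wd (a *: u + v)) x = (a *: lc (wd u) + lc (wd v)) x}.
Proof.
move=> wu wv; rewrite -local_part_lin; apply: local_part_ae.
apply: weak_derivative_ae.
by apply: is_weak_derivative_lin; exact: weak_derivativeP.
Qed.

Lemma subspace_finite_energy : subspace finite_energy.
Proof.
have lin a u v : finite_energy u -> finite_energy v -> finite_energy (a *: u + v).
  move=> [u0 u1 u2 uw u3] [v0 v1 v2 vw v3].
  have wuv := weakly_differentiable_lin a uw vw; split; [|exact: (subspace_L2set mu).2| |exact: wuv|].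
  - by move=> x xd; rewrite fct_linE u0// v0// mulr0 addr0.
  - by rewrite nonlocal_part_lin; exact: (subspace_L2set mu2).2.
  - apply: L2set_ae (local_weak_derivative_lin a uw vw) _.
      by apply: local_part_measurable; exact: weak_derivative_measurable.
    exact: (subspace_L2set mu).2.
split; last exact: lin.
have w0 : is_weak_derivative half_line (0 : R -> R) 0.
  have h := smooth_is_weak_derivative (@smooth_flat R 0).
  have := is_weak_derivative_lin (-1) h h.
  by rewrite !scaleN1r !addNr.
have nl0 : nl 0 = 0.
  by have := nonlocal_part_lin (-1) 0 0; rewrite !scaleN1r !addNr.
have lc0 : lc 0 = 0.
  by have := local_part_lin (-1) 0 0; rewrite !scaleN1r !addNr.
have dw0 : weakly_differentiable half_line (0 : R -> R) by exists 0.
split => //.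
- exact: (subspace_L2set mu).1.
- by rewrite nl0; exact: (subspace_L2set mu2).1.
- apply: L2set_ae (local_part_ae (weak_derivative_ae w0)) _.
    by apply: local_part_measurable; exact: weak_derivative_measurable.
  by rewrite lc0; exact: (subspace_L2set mu).1.
Qed.

Lemma psd_nonlocal_form : psd_form finite_energy nonlocal_form.
Proof.
have [_ l p] := psd_L2ip mu2.
split=> [u v Eu Ev|a u v w|u [_ _ u2 _ _]]; [exact: L2ipC| |exact: p].
move=> [_ _ u2 _ _] [_ _ v2 _ _] [_ _ w2 _ _].
by rewrite /nonlocal_form nonlocal_part_lin; exact: l.
Qed.

Lemma psd_local_form : psd_form finite_energy local_form.
Proof.
have [_ l p] := psd_L2ip mu.
split=> [u v Eu Ev|a u v w|u [_ _ _ _ u3]]; [exact: L2ipC| |exact: p].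
move=> [_ _ _ uw u3] [_ _ _ vw v3] [_ _ _ ww w3].
rewrite -(l _ _ _ _ u3 v3 w3).
apply: L2ip_ae (local_weak_derivative_lin a uw vw).
- apply: local_part_measurable; apply: weak_derivative_measurable.
  exact: weakly_differentiable_lin.
- exact/L2set_measurable/((subspace_L2set mu).2 a _ _ u3 v3).
- exact: L2set_measurable w3.
Qed.

Lemma psd_energy : psd_form finite_energy energy.
Proof. exact: psd_form_sum psd_nonlocal_form psd_local_form. Qed.

Lemma psd_L2ip_finite_energy : psd_form finite_energy (L2ip mu).
Proof.
have [s l p] := psd_L2ip mu.
split=> [u v [_ ? _ _ _] [_ ? _ _ _]|a u v w [_ ? _ _ _] [_ ? _ _ _] [_ ? _ _ _]|u [_ ? _ _ _]].
- exact: s.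
- exact: l.
- exact: p.
Qed.

Lemma psd_energy_sobolev : psd_form finite_energy energy_sobolev.
Proof. exact: psd_form_sum psd_L2ip_finite_energy psd_energy. Qed.

Lemma b_qnl_energy u v : finite_energy u -> finite_energy v ->
  b_qnl gamma delta u v = (energy u v)%:E.
Proof.
move=> [_ _ u2 _ u3] [_ _ v2 _ v3]; rewrite b_qnlE EFinD.
by rewrite (L2ipE u2 v2) (L2ipE u3 v3).
Qed.

Lemma qnl_normE u : (forall x, ~ dom x -> u x = 0) ->
  qnl_norm gamma delta u =
  sqrte (sqint mu u + (sqint mu2 (nl u) + sqint mu (lc (wd u))))%E.
Proof.
move=> u0; rewrite /qnl_norm Lnorm2_sqr b_qnlE; congr (sqrte (_ + (_ + _)))%E.
apply: eq_integral => x _; rewrite patchE; case: ifPn => // xd.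
by rewrite u0//; apply/set_mem; rewrite in_setC.
Qed.

Lemma qnl_norm_energy u : finite_energy u ->
  qnl_norm gamma delta u = (Num.sqrt (energy_sobolev u u))%:E.
Proof.
move=> [u0 u1 u2 _ u3]; rewrite qnl_normE//.
by rewrite (sqintE u1) (sqintE u2) (sqintE u3).
Qed.

(** The three parts of the norm are nonnegative, so each of them is finite when
    the norm is. *)
Lemma qnl_norm_finite_energy u : (forall x, ~ dom x -> u x = 0) ->
  measurable_fun setT u -> weakly_differentiable half_line u ->
  (qnl_norm gamma delta u < +oo)%E -> finite_energy u.
Proof.
move=> u0 mf wu; rewrite qnl_normE// => fin.
have m2 := nonlocal_part_measurable mf.
have m3 := local_part_measurable (weak_derivative_measurable wu).
have : (sqint mu u + (sqint mu2 (nl u) + sqint mu (lc (wd u))) < +oo)%E.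
  move: fin; case: (_ + _)%E => //= x; rewrite ltry => _; exact: ltry.
have p1 := sqint_ge0 mu u; have p2 := sqint_ge0 mu2 (nl u).
have p3 := sqint_ge0 mu (lc (wd u)) => s.
have s1 : (sqint mu u < +oo)%E.
  by apply: le_lt_trans s; rewrite leeDl// adde_ge0.
have s23 : (sqint mu2 (nl u) + sqint mu (lc (wd u)) < +oo)%E.
  by apply: le_lt_trans s; rewrite leeDr.
split => //; apply/L2setP; split => //.
  by apply: le_lt_trans s23; rewrite leeDl.
by apply: le_lt_trans s23; rewrite leeDr.
Qed.

End finite_energy.

(** * The energy of test functions *)

Section test_function_energy.
Context {R : realType} (gamma : R -> R) (delta : R).
Context (hgamma : admissible_kernel gamma) (delta0 : 0 < delta).
Implicit Types (f g h phi : R -> R).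
Local Notation mu := (@lebesgue_measure R).
Local Notation mu2 := (mu \x mu)%E.
Local Notation nl := (nonlocal_part gamma delta).
Local Notation lc := (local_part gamma delta).
Local Notation k2 := (moment_density gamma delta).

Lemma OmegaE (x : R) : Omega x <-> -1 < x < 1.
Proof. by rewrite /Omega/= in_itv. Qed.

Lemma test_function_Omega phi : test_function Omega phi ->
  [/\ smooth phi, continuous phi, continuous (derive1 phi) & exists a b,
   [/\ -1 < a, a < b, b < 1, supported_in a b phi &
     supported_in a b (derive1 phi)]].
Proof.
have oO : open (@Omega R) by exact: interval_open.
have iO : is_interval (@Omega R) by exact: interval_is_interval.
have nO : @Omega R !=set0 by exists 0; apply/OmegaE; rewrite ltr01 oppr_lt0 ltr01.
move=> /(test_function_supported oO iO nO)[sphi [a [b [ab abD sup sup']]]].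
split => //; first exact: smooth_continuous.
  by apply: smooth_continuous; exact: smooth_derive1.
exists a, b; split => //.
  by have /OmegaE/andP[] : Omega a by apply: abD; rewrite /= in_itv/= lexx ltW.
by have /OmegaE/andP[] : Omega b by apply: abD; rewrite /= in_itv/= lexx ltW.
Qed.

Lemma test_function_outside phi x : test_function Omega phi ->
  x <= -1 \/ 1 <= x -> phi x = 0.
Proof.
move=> /test_function_Omega[_ _ _ [a [b [a1 ab b1 sup _]]]] xab.
by apply: sup; case: xab => h; [left|right]; lra.
Qed.

Lemma test_function_notin phi x : test_function Omega phi -> ~ Omega x -> phi x = 0.
Proof.
move=> tphi xO; apply: (test_function_outside tphi).
have [x1|x1] := leP x (-1); first by left.
by right; rewrite leNgt; apply/negP => x2; apply/xO/OmegaE; rewrite x1.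
Qed.

Lemma test_function_lipschitz phi : test_function Omega phi ->
  exists2 M : R, 0 <= M & forall x y, (phi y - phi x) ^+ 2 <= M * (y - x) ^+ 2.
Proof.
move=> /test_function_Omega[sphi cphi cphi' [a [b [a1 ab b1 sup sup']]]].
have [M M0 hM] := supported_bounded cphi' sup'.
have lip x y : x < y -> (phi y - phi x) ^+ 2 <= M ^+ 2 * (y - x) ^+ 2.
  move=> xy.
  have [c _ ->] : exists2 c, c \in `]x, y[ & phi y - phi x = derive1 phi c * (y - x).
    apply: MVT => //; first by move=> z _; exact: smooth_is_derive.
    by apply: continuous_subspaceT.
  rewrite exprMn ler_wpM2r ?sqr_ge0//.
  by rewrite -(real_normK (num_real (derive1 phi c))) lerXn2r ?nnegrE.
exists (M ^+ 2); first exact: sqr_ge0.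
move=> x y; have [xy|yx|->] := ltgtP x y.
- exact: lip.
- by rewrite -(opprB (phi x)) -(opprB x) !sqrrN; exact: lip.
- by rewrite !subrr expr0n/= mulr0.
Qed.

Lemma ge0_integral_translate (f : R -> R) (b : R) : (forall x, 0 <= f x) ->
  measurable_fun setT f -> (\int[mu]_x (f (x - b))%:E = \int[mu]_x (f x)%:E)%E.
Proof.
move=> f0 mf; rewrite [RHS](ge0_integral_affine (- b) ltr01)// mul1e.
by apply: eq_integral => x _; rewrite mul1r.
Qed.

Local Notation RR := (measurableTypeR R * measurableTypeR R)%type.

Lemma measurable_fst_fun f : measurable_fun setT f ->
  measurable_fun (setT : set RR) (fun p => f p.1).
Proof. by move=> mf; apply: (measurableT_comp mf); exact: measurable_fst. Qed.

Lemma measurable_snd_fun f : measurable_fun setT f ->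
  measurable_fun (setT : set RR) (fun p => f p.2).
Proof. by move=> mf; apply: (measurableT_comp mf); exact: measurable_snd. Qed.

Lemma measurable_diff_fun f : measurable_fun setT f ->
  measurable_fun (setT : set RR) (fun p => f (p.2 - p.1)).
Proof.
move=> mf; apply: (measurableT_comp mf); apply: measurable_funB.
  exact: measurable_snd.
exact: measurable_fst.
Qed.

Lemma moment_densityC (x y : R) : k2 (x - y) = k2 (y - x).
Proof. by rewrite /moment_density /gamma_delta distrC. Qed.

(** Tonelli's theorem: the density has mass 1 in y for every x. *)
Lemma integral_moment_fst (A : set (measurableTypeR R)) : measurable A ->
  (\int[mu2]_p (\1_A p.1 * k2 (p.2 - p.1))%:E = mu A)%E.
Proof.
move=> mA; have mk := moment_density_measurable hgamma delta0.
have k0 := moment_density_ge0 hgamma delta0.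
have m1A : measurable_fun setT (\1_A : R -> R) by exact: measurable_indic.
rewrite fubini_tonelli1//=; last 2 first.
- apply/measurable_EFinP; apply: measurable_funM.
    exact: measurable_fst_fun m1A.
  exact: measurable_diff_fun mk.
- by move=> p; rewrite lee_fin mulr_ge0.
transitivity (\int[mu]_x (\1_A x)%:E)%E; last by rewrite integral_indic// setIT.
apply: eq_integral => x _; rewrite /fubini_F/=.
under eq_integral do rewrite EFinM.
rewrite ge0_integralZl_EFin//; last 2 first.
- by move=> y _; rewrite lee_fin.
- apply/measurable_EFinP; apply: (measurableT_comp mk).
  exact: measurable_funB.
by rewrite (ge0_integral_translate x k0 mk) moment_density_integral// mule1.
Qed.

Lemma integral_moment_snd (A : set (measurableTypeR R)) : measurable A ->
  (\int[mu2]_p (\1_A p.2 * k2 (p.2 - p.1))%:E = mu A)%E.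
Proof.
move=> mA; have mk := moment_density_measurable hgamma delta0.
have k0 := moment_density_ge0 hgamma delta0.
have m1A : measurable_fun setT (\1_A : R -> R) by exact: measurable_indic.
rewrite fubini_tonelli2//=; last 2 first.
- apply/measurable_EFinP; apply: measurable_funM.
    exact: measurable_snd_fun m1A.
  exact: measurable_diff_fun mk.
- by move=> p; rewrite lee_fin mulr_ge0.
transitivity (\int[mu]_x (\1_A x)%:E)%E; last by rewrite integral_indic// setIT.
apply: eq_integral => x _; rewrite /fubini_G/=.
under eq_integral do rewrite EFinM moment_densityC.
rewrite ge0_integralZl_EFin//; last 2 first.
- by move=> y _; rewrite lee_fin.
- apply/measurable_EFinP; apply: (measurableT_comp mk).
  exact: measurable_funB.
by rewrite (ge0_integral_translate x k0 mk) moment_density_integral// mule1.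
Qed.

Lemma integral_tensor f g : measurable_fun setT f -> measurable_fun setT g ->
  (forall x, 0 <= f x) -> (forall x, 0 <= g x) ->
  (\int[mu2]_p (f p.1 * g p.2)%:E = \int[mu]_x (f x)%:E * \int[mu]_x (g x)%:E)%E.
Proof.
move=> mf mg f0 g0; rewrite fubini_tonelli1//=; last 2 first.
- apply/measurable_EFinP; apply: measurable_funM.
    exact: measurable_fst_fun mf.
  exact: measurable_snd_fun mg.
- by move=> p; rewrite lee_fin mulr_ge0.
rewrite -ge0_integralZr//; last 3 first.
- exact/measurable_EFinP.
- by move=> x _; rewrite lee_fin.
- by apply: integral_ge0 => x _; rewrite lee_fin.
apply: eq_integral => x _; rewrite /fubini_F/=.
under eq_integral do rewrite EFinM.
rewrite ge0_integralZl_EFin//; last exact/measurable_EFinP.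
by move=> y _; rewrite lee_fin.
Qed.

Lemma Omega_measurable : measurable (Omega : set (measurableTypeR R)).
Proof. by rewrite /Omega. Qed.

Lemma Omega_measure : (mu (Omega : set R) = 2%:E)%E.
Proof.
by rewrite /Omega lebesgue_measure_itv/= lte_fin ifT; [rewrite opprK|lra].
Qed.

Lemma bounded_Omega_L2set f (M : R) : measurable_fun setT f ->
  (forall x, `|f x| <= M) -> (forall x, ~ Omega x -> f x = 0) -> L2set mu f.
Proof.
move=> mf fM f0; apply: (bounded_L2set Omega_measurable _ mf fM f0).
by rewrite [X in (X < _)%E](_ : _ = 2%:E)%E ?ltry//; exact: Omega_measure.
Qed.

Lemma test_function_bounded phi : test_function Omega phi ->
  exists2 M : R, 0 <= M & forall x, `|phi x| <= M /\ `|derive1 phi x| <= M.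
Proof.
move=> /test_function_Omega[sphi cphi cphi' [a [b [a1 ab b1 sup sup']]]].
have [M M0 hM] := supported_bounded cphi sup.
have [M' M0' hM'] := supported_bounded cphi' sup'.
exists (M + M'); first exact: addr_ge0.
by move=> x; split; [apply: (le_trans (hM x)); rewrite lerDl|
  apply: (le_trans (hM' x)); rewrite lerDr].
Qed.

Lemma test_function_L2set phi : test_function Omega phi -> L2set mu phi.
Proof.
move=> tphi; have [M M0 hM] := test_function_bounded tphi.
have [sphi _ _ _] := test_function_Omega tphi.
apply: (@bounded_Omega_L2set _ M); first exact: smooth_measurable.
  by move=> x; have [] := hM x.
by move=> x; exact: test_function_notin.
Qed.

Lemma test_function_local_L2set phi : test_function Omega phi ->
  L2set mu (lc (derive1 phi)).
Proof.
move=> tphi; have [M M0 hM] := test_function_bounded tphi.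
have [sphi _ _ [a [b [a1 ab b1 _ sup']]]] := test_function_Omega tphi.
apply: (@bounded_Omega_L2set _ M).
- apply: local_part_measurable => //.
  by apply: smooth_measurable; exact: smooth_derive1.
- move=> x; rewrite /lc patchE; case: ifPn => [/set_mem/half_lineE x0|_]; last by rewrite normr0.
  have [_ h] := hM x; apply: le_trans h.
  rewrite normrM ler_piMl// ger0_norm ?sqrtr_ge0//.
  by rewrite -[leRHS]sqrtr1 ler_sqrt// omega_le1.
- move=> x xO; rewrite /lc patchE; case: ifPn => // _.
  rewrite sup' ?mulr0//; have [x1|x1] := leP x a; first by left.
  right; rewrite leNgt; apply/negP => x2; apply/xO/OmegaE; apply/andP; split; lra.
Qed.

(** The Lipschitz bound of phi turns the kernel into the moment density, and
    the difference vanishes unless x or y lies in Omega, which has finite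
    measure. *)
Lemma test_function_nonlocal_L2set phi : test_function Omega phi ->
  L2set mu2 (nl phi).
Proof.
move=> tphi; have [M M0 hM] := test_function_lipschitz tphi.
have [sphi _ _ _] := test_function_Omega tphi.
have mphi : measurable_fun setT phi by exact: smooth_measurable.
have mnl := nonlocal_part_measurable hgamma delta0 mphi.
have mk := moment_density_measurable hgamma delta0.
have k0 := moment_density_ge0 hgamma delta0.
have m1 : measurable_fun setT (\1_Omega : R -> R) by exact: measurable_indic Omega_measurable.
apply/L2setP; split => //.
pose F1 (p : RR) := \1_Omega p.1 * k2 (p.2 - p.1).
pose F2 (p : RR) := \1_Omega p.2 * k2 (p.2 - p.1).
have mF1 : measurable_fun setT F1.
  apply: measurable_funM; [exact: measurable_fst_fun m1|exact: measurable_diff_fun mk].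
have mF2 : measurable_fun setT F2.
  apply: measurable_funM; [exact: measurable_snd_fun m1|exact: measurable_diff_fun mk].
have F10 p : 0 <= F1 p by rewrite mulr_ge0.
have F20 p : 0 <= F2 p by rewrite mulr_ge0.
apply: (@le_lt_trans _ _ (\int[mu2]_p (M * (F1 p + F2 p))%:E)%E).
  apply: ge0_le_integral => //.
  - by move=> p _; rewrite lee_fin sqr_ge0.
  - by apply/measurable_EFinP; exact: measurable_funX.
  - apply/measurable_EFinP; apply: measurable_funM => //.
    exact: measurable_funD.
  - move=> [x y] _; rewrite lee_fin /F1 /F2 /=.
    rewrite -mulrDl /nl patchE; case: ifPn => _; last first.
      by rewrite expr0n/= mulr_ge0// mulr_ge0// addr_ge0.
    rewrite /= exprMn sqr_sqrtr ?gamma_delta_ge0//.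
    have [xyO|xyO] := pselect (Omega x \/ Omega y); last first.
      have out z := @test_function_notin _ z tphi.
      have xO : ~ Omega x by move=> xO; apply: xyO; left.
      have yO : ~ Omega y by move=> yO; apply: xyO; right.
      by rewrite (out _ xO) (out _ yO) subrr expr0n/= mulr0 mulr_ge0// mulr_ge0// addr_ge0.
    apply: (@le_trans _ _ (M * k2 (y - x))).
      rewrite /moment_density real_normK ?num_real//.
      rewrite [leRHS]mulrA [leRHS]mulrC.
      by apply: ler_wpM2l; [exact: gamma_delta_ge0|exact: hM].
    rewrite ler_wpM2l// ler_peMl// !indicE.
    by case: xyO => /mem_set ->; rewrite ?lerDl ?lerDr.
under eq_integral do rewrite EFinM.
rewrite ge0_integralZl_EFin//; last 2 first.
- by move=> p _; rewrite lee_fin addr_ge0.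
- by apply/measurable_EFinP; exact: measurable_funD.
under eq_integral do rewrite EFinD.
rewrite ge0_integralD//; last 4 first.
- by move=> p _; rewrite lee_fin.
- exact/measurable_EFinP.
- by move=> p _; rewrite lee_fin.
- exact/measurable_EFinP.
rewrite integral_moment_fst ?integral_moment_snd ?Omega_measure; last 2 first.
- exact: Omega_measurable.
- exact: Omega_measurable.
by rewrite -EFinD -EFinM ltry.
Qed.

Lemma test_function_finite_energy phi : test_function Omega phi ->
  finite_energy gamma delta phi.
Proof.
move=> tphi; have [sphi _ _ _] := test_function_Omega tphi.
have wphi := smooth_is_weak_derivative sphi.
have dphi : weakly_differentiable half_line phi by exists (derive1 phi).
split => //.
- by move=> x xD; apply: (test_function_notin tphi) => xO; apply: xD; left.
- exact: test_function_L2set.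
- exact: test_function_nonlocal_L2set.
- apply: L2set_ae (local_part_ae _ _ (weak_derivative_ae wphi)) _.
    apply: local_part_measurable => //.
    exact: weak_derivative_measurable.
  exact: test_function_local_L2set.
Qed.

End test_function_energy.

(** * Poincare inequality *)

Section poincare.
Context {R : realType} (gamma : R -> R) (delta : R).
Context (hgamma : admissible_kernel gamma) (delta0 : 0 < delta).
Implicit Types (f h phi : R -> R).
Local Notation mu := (@lebesgue_measure R).
Local Notation mu2 := (mu \x mu)%E.
Local Notation RR := (measurableTypeR R * measurableTypeR R)%type.
Local Notation gd := (gamma_delta gamma delta).
Local Notation om := (omega_delta gamma delta).
Local Notation nl := (nonlocal_part gamma delta).
Local Notation lc := (local_part gamma delta).

Definition mass_on phi (i : interval R) : \bar R :=
  (\int[mu]_(x in [set` i]) (phi x ^+ 2)%:E)%E.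

Lemma mass_onE phi i : mass_on phi i = (\int[mu]_x (\1_[set` i] x * phi x ^+ 2)%:E)%E.
Proof.
rewrite /mass_on integral_mkcond; apply: eq_integral => x _.
by rewrite patchE indicE; case: ifPn => _; rewrite ?mul1r ?mul0r.
Qed.

Lemma mass_on_ge0 phi i : (0 <= mass_on phi i)%E.
Proof. by apply: integral_ge0 => x _; rewrite lee_fin sqr_ge0. Qed.

(** For x and y in the adjacent cells, y - x < 2 h <= rho bounds the kernel
    below by c; the inequality
    phi(y)^2 <= 2 phi(x)^2 + 2 (phi(y) - phi(x))^2 is integrated over the
    product of the cells. *)
Lemma nonlocal_step phi (a h c rho : R) : measurable_fun setT phi ->
  0 < c -> (forall s, 0 < `|s| -> `|s| < rho -> c <= gd s) ->
  a <= 0 -> 0 < h -> 2 * h <= rho ->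
  (h%:E * mass_on phi `[a, (a + h)%R[ <=
   (2 * h)%:E * mass_on phi `[(a - h)%R, a[ + (2 / c)%:E * sqint mu2 (nl phi))%E.
Proof.
move=> mphi c0 hc a0 h0 hrho.
pose I : set R := [set` `[a - h, a[%R]; pose J : set R := [set` `[a, a + h[%R].
have mIs : measurable (I : set (measurableTypeR R)) by exact: measurable_itv.
have mJs : measurable (J : set (measurableTypeR R)) by exact: measurable_itv.
have mI : measurable_fun setT (\1_I : R -> R) by exact: measurable_indic mIs.
have mJ : measurable_fun setT (\1_J : R -> R) by exact: measurable_indic mJs.
have mp2 : measurable_fun setT (fun x => phi x ^+ 2) by exact: measurable_funX.
have mIp : measurable_fun setT (fun x => \1_I x * phi x ^+ 2) by exact: measurable_funM.
have mJp : measurable_fun setT (fun x => \1_J x * phi x ^+ 2) by exact: measurable_funM.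
have mnl := nonlocal_part_measurable hgamma delta0 mphi.
have muI : (\int[mu]_x (\1_I x)%:E = h%:E)%E.
  rewrite integral_indic// setIT [LHS]lebesgue_measure_itv/= lte_fin ifT; last by lra.
  by rewrite -EFinD; congr EFin; lra.
have muJ : (\int[mu]_x (\1_J x)%:E = h%:E)%E.
  rewrite integral_indic// setIT [LHS]lebesgue_measure_itv/= lte_fin ifT; last by lra.
  by rewrite -EFinD; congr EFin; lra.
have -> : (h%:E * mass_on phi `[a, (a + h)%R[)%E =
    (\int[mu2]_p (\1_I p.1 * (\1_J p.2 * phi p.2 ^+ 2))%:E)%E.
  rewrite (@integral_tensor _ (\1_I) (fun y => \1_J y * phi y ^+ 2))//.
    by rewrite muI mass_onE.
  by move=> x; rewrite mulr_ge0 ?sqr_ge0.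
have -> : ((2 * h)%:E * mass_on phi `[(a - h)%R, a[)%E =
    (\int[mu2]_p (2 * ((\1_I p.1 * phi p.1 ^+ 2) * \1_J p.2))%:E)%E.
  under [RHS]eq_integral do rewrite EFinM.
  have m2 : measurable_fun (setT : set RR) (fun p => (\1_I p.1 * phi p.1 ^+ 2) * \1_J p.2).
    apply: measurable_funM; first exact: measurable_fst_fun mIp.
    exact: measurable_snd_fun mJ.
  rewrite ge0_integralZl_EFin//; last 2 first.
  - by move=> p _; rewrite lee_fin mulr_ge0// mulr_ge0 ?sqr_ge0.
  - exact/measurable_EFinP.
  rewrite (@integral_tensor _ (fun x => \1_I x * phi x ^+ 2) (\1_J))//.
    by rewrite muJ mass_onE EFinM -muleA [X in (_ * X = _)%E]muleC.
  by move=> x; rewrite mulr_ge0 ?sqr_ge0.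
have -> : ((2 / c)%:E * sqint mu2 (nl phi))%E =
    (\int[mu2]_p ((2 / c) * nl phi p ^+ 2)%:E)%E.
  under [RHS]eq_integral do rewrite EFinM.
  rewrite ge0_integralZl_EFin//.
  - by move=> p _; rewrite lee_fin sqr_ge0.
  - by apply/measurable_EFinP; exact: measurable_funX.
  - by rewrite divr_ge0// ltW.
have m3 : measurable_fun (setT : set RR)
    (fun p => 2 * ((\1_I p.1 * phi p.1 ^+ 2) * \1_J p.2)).
  apply: measurable_funM => //; apply: measurable_funM.
    exact: measurable_fst_fun mIp.
  exact: measurable_snd_fun mJ.
have m4 : measurable_fun (setT : set RR) (fun p => (2 / c) * nl phi p ^+ 2).
  by apply: measurable_funM => //; exact: measurable_funX.
rewrite -ge0_integralD//; last 4 first.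
- by move=> p _; rewrite lee_fin mulr_ge0// mulr_ge0// mulr_ge0 ?sqr_ge0.
- exact/measurable_EFinP.
- by move=> p _; rewrite lee_fin mulr_ge0 ?sqr_ge0// divr_ge0// ltW.
- exact/measurable_EFinP.
apply: ge0_le_integral => //.
- by move=> p _; rewrite lee_fin mulr_ge0// mulr_ge0 ?sqr_ge0.
- apply/measurable_EFinP; apply: measurable_funM; first exact: measurable_fst_fun mI.
  exact: measurable_snd_fun mJp.
- by apply: emeasurable_funD; exact/measurable_EFinP.
move=> [x y] _ /=; rewrite -EFinD lee_fin !indicE.
have k0 : 0 <= 2 / c * nl phi (x, y) ^+ 2 by rewrite mulr_ge0 ?sqr_ge0// divr_ge0// ltW.
have [|_] := boolP (x \in I); last by rewrite !mul0r mulr0 add0r.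
have [|_] := boolP (y \in J); last by rewrite !mul0r !mulr0 add0r.
rewrite !inE /I /J /= !in_itv/= => /andP[y1 y2] /andP[x1 x2].
rewrite !mul1r mulr1 /nl patchE mem_set/=; last by left; rewrite /=; lra.
rewrite exprMn sqr_sqrtr ?gamma_delta_ge0//.
have cg : c <= gd (y - x).
  by apply: hc; rewrite gtr0_norm; lra.
have d0 : (phi y - phi x) ^+ 2 <= c^-1 * (gd (y - x) * (phi y - phi x) ^+ 2).
  by rewrite mulrA ler_peMl ?sqr_ge0// ler_pdivlMl// mulr1.
have : phi y ^+ 2 <= 2 * phi x ^+ 2 + 2 * (phi y - phi x) ^+ 2.
  have := sqr_ge0 (phi y - 2 * phi x); rewrite !sqrrB; lra.
by rewrite -[2 / c * _]mulrA; lra.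
Qed.

(** Cauchy-Schwarz against the indicator of [a, b]. *)
Lemma sqr_Rintegral_itv f (a b : R) : a < b -> L2set mu (f \_ `[a, b]) ->
  (((\int[mu]_(x in `[a, b]) f x) ^+ 2)%:E <=
   (b - a)%:E * \int[mu]_(x in `[a, b]) (f x ^+ 2)%:E)%E.
Proof.
move=> ab Lf; pose e : R -> R := \1_(`[a, b]%classic).
have me : measurable_fun setT e by exact: measurable_indic.
have se : sqint mu e = (b - a)%:E.
  transitivity (\int[mu]_x (e x)%:E)%E.
    by apply: eq_integral => x _; rewrite /e indicE; case: (_ \in _); rewrite ?expr1n ?expr0n.
  rewrite integral_indic// setIT [LHS]lebesgue_measure_itv/= lte_fin ab.
  by rewrite -EFinD.
have Le : L2set mu e by apply/L2setP; rewrite se ltry.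
have sf : sqint mu (f \_ `[a, b]) = (\int[mu]_(x in `[a, b]) (f x ^+ 2)%:E)%E.
  rewrite [RHS]integral_mkcond; apply: eq_integral => x _.
  by rewrite !patchE; case: ifPn => // _; rewrite expr0n.
have := psd_cauchy_schwarz (subspace_L2set mu) (psd_L2ip mu) Lf Le.
rewrite -lee_fin [leRHS]EFinM -(sqintE Lf) -(sqintE Le) se sf muleC; apply: le_trans.
rewrite lee_fin le_eqVlt; apply/orP; left; apply/eqP; congr (_ ^+ 2).
rewrite Rintegral_mkcond; apply: eq_Rintegral => x _; rewrite /e patchE indicE.
by case: ifPn => _; rewrite ?mulr1 ?mul0r.
Qed.

(** Since phi(1) = 0, phi(x) is minus the integral of its derivative over
    [x, 1], where the weight is at least its value at x0. *)
Lemma local_poincare phi (x0 : R) : test_function Omega phi -> 0 < x0 -> x0 < 1 ->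
  (mass_on phi `[x0, 1%R] <= (om x0)^-1%:E * sqint mu (lc (derive1 phi)))%E.
Proof.
move=> tphi x00 x01.
have [sphi cphi cphi' _] := test_function_Omega tphi.
have mphi' : measurable_fun setT (derive1 phi).
  by apply: smooth_measurable; exact: smooth_derive1.
have om0 : 0 < om x0 by exact: omega_gt0.
have lphi' := test_function_local_L2set hgamma delta0 tphi.
pose J : \bar R := (\int[mu]_(x in `[x0, 1%R]) (derive1 phi x ^+ 2)%:E)%E.
have Jle : (J <= (om x0)^-1%:E * sqint mu (lc (derive1 phi)))%E.
  rewrite /J integral_mkcond /sqint -ge0_integralZl_EFin//; last 3 first.
  - by move=> x _; rewrite lee_fin sqr_ge0.
  - by apply/measurable_EFinP/measurable_funX; exact: L2set_measurable lphi'.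
  - by rewrite invr_ge0 ltW.
  apply: ge0_le_integral => //.
  - by move=> x _; rewrite patchE; case: ifPn => // _; rewrite lee_fin sqr_ge0.
  - apply: (measurable_restrictT _ (measurable_itv _)).1; apply/measurable_EFinP.
    by apply: measurable_funX; exact: measurable_funS mphi'.
  - apply: emeasurable_funM => //.
    by apply/measurable_EFinP/measurable_funX; exact: L2set_measurable lphi'.
  - move=> x _; rewrite patchE; case: ifPn => [/set_mem|_]; last first.
      by rewrite -EFinM lee_fin mulr_ge0 ?sqr_ge0// invr_ge0 ltW.
    rewrite /= in_itv/= => /andP[x0x x1]; have xp : 0 < x by lra.
    rewrite -EFinM lee_fin /lc patchE mem_set; last exact/half_lineE.
    rewrite exprMn sqr_sqrtr; last by apply/omega_ge0 => //; exact/half_lineE.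
    have scale (p q r : R) : 0 < p -> p <= q -> r ^+ 2 <= p^-1 * (q * r ^+ 2).
      by move=> p0 pq; rewrite mulrA ler_peMl ?sqr_ge0// ler_pdivlMl// mulr1.
    exact: (scale _ _ _ om0 (omega_homo hgamma delta0 x00 x0x)).
apply: le_trans Jle.
have pointwise x : x0 <= x -> x <= 1 -> ((phi x ^+ 2)%:E <= J)%E.
  move=> x0x; rewrite le_eqVlt => /orP[/eqP ->|x1].
    rewrite (test_function_outside tphi); last by right.
    by rewrite expr0n; apply: integral_ge0 => y _; rewrite lee_fin sqr_ge0.
  have L1 : L2set mu (derive1 phi \_ `[x, 1]).
    have [M M0 hM] := test_function_bounded tphi.
    have [_ _ _ [a [b [a1 ab b1 _ sup']]]] := test_function_Omega tphi.
    apply: (@bounded_Omega_L2set _ _ M).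
    - apply: (measurable_restrictT _ (measurable_itv _)).1; exact: measurable_funS mphi'.
    - move=> y; rewrite patchE; case: ifPn => _; last by rewrite normr0.
      by have [] := hM y.
    - move=> y yO; rewrite patchE; case: ifPn => // _.
      apply: sup'; have [ya|ya] := leP y a; first by left.
      right; rewrite leNgt; apply/negP => yb; apply/yO/OmegaE; apply/andP; split; lra.
  have phiE : \int[mu]_(y in `[x, 1%R]) derive1 phi y = - phi x.
    rewrite /Rintegral (@continuous_FTC2 _ _ phi)//.
    - by rewrite (test_function_outside tphi (or_intror (lexx 1))) -EFinB/= sub0r.
    - exact: continuous_subspaceT.
    - exact: smooth_derivable_oo.
  have := sqr_Rintegral_itv x1 L1; rewrite phiE sqrrN => /le_trans; apply.
  apply: (@le_trans _ _ (1%:E * \int[mu]_(y in `[x, 1%R]) (derive1 phi y ^+ 2)%:E)%E).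
    apply: lee_wpmul2r; last by rewrite lee_fin; lra.
    by apply: integral_ge0 => y _; rewrite lee_fin sqr_ge0.
  rewrite mul1e; apply: ge0_subset_integral => //.
  - by apply/measurable_EFinP/measurable_funX; exact: measurable_funS mphi'.
  - by move=> y _; rewrite lee_fin sqr_ge0.
  - by apply: subset_itvr; rewrite bnd_simp.
apply: (@le_trans _ _ (\int[mu]_(x in `[x0, 1%R]) J)%E).
  apply: ge0_le_integral => //.
  - by move=> x _; rewrite lee_fin sqr_ge0.
  - apply/measurable_EFinP; apply: measurable_funX.
    by apply: smooth_measurable.
  - by move=> x /=; rewrite in_itv/= => /andP[h1 h2]; exact: pointwise.
rewrite integral_cst// [X in (_ * X)%E](_ : _ = (1 - x0)%:E); last first.
  by rewrite [LHS]lebesgue_measure_itv/= lte_fin x01 -EFinD.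
apply: (@le_trans _ _ (J * 1%:E)%E); last by rewrite mule1.
apply: lee_wpmul2l; first by apply: integral_ge0 => x _; rewrite lee_fin sqr_ge0.
by rewrite lee_fin; lra.
Qed.

Lemma mass_on_sub phi (i j : interval R) : measurable_fun setT phi ->
  [set` i] `<=` [set` j] -> (mass_on phi i <= mass_on phi j)%E.
Proof.
move=> mphi ij; apply: ge0_subset_integral => //.
- by apply/measurable_EFinP/measurable_funX; exact: measurable_funS mphi.
- by move=> x _; rewrite lee_fin sqr_ge0.
Qed.

Lemma mass_on_split phi (x y : itv_bound R) (c : R) : measurable_fun setT phi ->
  (x <= BLeft c)%O -> (BLeft c <= y)%O ->
  mass_on phi (Interval x y) =
    (mass_on phi (Interval x (BLeft c)) + mass_on phi (Interval (BLeft c) y))%E.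
Proof.
move=> mphi xc cy; rewrite /mass_on (@itv_bndbnd_setU _ _ x (BLeft c) y)//.
rewrite ge0_integral_setU//.
- by apply/measurable_EFinP/measurable_funX; exact: measurable_funS mphi.
- by move=> z _; rewrite lee_fin sqr_ge0.
- apply/disj_setPS => z [/=]; rewrite !itv_boundlr /= => /andP[_ zc] /andP[cz _].
  by move: zc cz; rewrite !bnd_simp => /lt_le_trans/[apply]; rewrite ltxx.
Qed.

Lemma mass_on_fin phi i : L2set mu phi -> mass_on phi i \is a fin_num.
Proof.
move=> /L2setP[mphi]; rewrite ge0_fin_numE ?mass_on_ge0//; apply: le_lt_trans.
apply: ge0_subset_integral => //.
- by apply/measurable_EFinP/measurable_funX.
- by move=> x _; rewrite lee_fin sqr_ge0.
Qed.

(** Iteration of [nonlocal_step] from the cells before -1, where phi vanishes.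
    With h = 1/N the steps stop exactly at 0, and one more step, whose left
    cell is [-h, 0[, goes across the interface up to x0 = h. *)
Lemma nonlocal_poincare : exists C x0 : R, [/\ 0 <= C, 0 < x0, x0 < 1 &
  forall phi, test_function Omega phi ->
    (mass_on phi `]-oo, x0[ <= C%:E * sqint mu2 (nl phi))%E].
Proof.
have [c [rho [c0 rho0 hc]]] := gamma_delta_bounded_below hgamma delta0.
(* N is at least 2, for x0 = h < 1, and at least 2 / rho, for 2 h <= rho. *)
pose N := (Num.bound (2 / rho)).+2; pose h : R := N%:R^-1.
have h0 : 0 < h by rewrite invr_gt0 ltr0n.
have Nh : N%:R * h = 1 by rewrite divff// pnatr_eq0.
have h1 : h < 1 by rewrite invf_lt1 ?ltr0n// ltr1n.
have hrho : 2 * h <= rho.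
  rewrite ler_pdivrMr ?ltr0n// mulrC -ler_pdivrMr//.
  apply/ltW/(@lt_trans _ _ (Num.bound (2 / rho))%:R); last by rewrite ltr_nat.
  by apply: archi_boundP; rewrite divr_ge0// ltW.
have chain k : (k <= N.+1)%N -> exists2 C : R, 0 <= C & forall phi,
    test_function Omega phi ->
    (mass_on phi `]-oo, (-1 + k%:R * h)%R[ <= C%:E * sqint mu2 (nl phi))%E.
  elim: k => [_|k IH kN].
    exists 0 => // phi tphi; rewrite mul0e mul0r addr0 /mass_on integral0_eq//.
    move=> x /=; rewrite in_itv/= => x1.
    by rewrite (test_function_outside tphi) ?expr0n//; left; exact: ltW.
  have [C C0 hC] := IH (ltnW kN).
  (* The mass of the new cell is at most 2 C + 2 / (c h) times the energy, and
     that of all the previous ones is at most C times the energy. *)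
  exists (3 * C + 2 / c / h) => [|phi tphi].
    by rewrite addr_ge0 ?mulr_ge0 ?invr_ge0 ?(ltW c0) ?(ltW h0).
  have [sphi _ _ _] := test_function_Omega tphi.
  have mphi : measurable_fun setT phi by exact: smooth_measurable.
  have Lphi := test_function_L2set tphi.
  have LE := test_function_nonlocal_L2set hgamma delta0 tphi.
  set a : R := -1 + k%:R * h.
  have a0 : a <= 0.
    have : k%:R * h <= N%:R * h by rewrite ler_pM2r// ler_nat.
    by rewrite Nh /a; lra.
  have -> : -1 + k.+1%:R * h = a + h by rewrite -natr1 /a; ring.
  have := nonlocal_step mphi c0 hc a0 h0 hrho.
  have := hC _ tphi; rewrite -/a.
  rewrite (@mass_on_split phi -oo%O (BLeft (a + h)) a)//; last by rewrite bnd_simp lerDl ltW.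
  have := @mass_on_sub phi `[(a - h)%R, a[ `]-oo, a[ mphi (subset_itvr _).
  rewrite -(fineK (mass_on_fin `]-oo, a[ Lphi)) -(fineK (mass_on_fin `[a, (a + h)%R[ Lphi)).
  rewrite -(fineK (mass_on_fin `[(a - h)%R, a[ Lphi)) (sqintE LE).
  move: (fine _) (fine _) (fine _) (L2ip _ _ _) => m1 m2 m3 e.
  rewrite -!EFinM -!EFinD !lee_fin => /(_ isT) m31 m1C step.
  have -> : (3 * C + 2 / c / h) * e = 3 * (C * e) + h^-1 * (2 / c * e) by ring.
  have : m1 <= 2 * m3 + h^-1 * (2 / c * e).
    rewrite -(ler_pM2l h0) mulrDr [h * (h^-1 * _)]mulrA divff ?lt0r_neq0// mul1r.
    by rewrite mulrA [h * 2]mulrC.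
  lra.
have [C C0 hC] := chain N.+1 (leqnn _).
exists C, h; split => // phi tphi; have := hC _ tphi.
by have -> : -1 + N.+1%:R * h = h by rewrite -natr1 mulrDl Nh; ring.
Qed.

Lemma local_weak_derivative_test phi : test_function Omega phi ->
  sqint mu (lc (weak_derivative half_line phi)) = sqint mu (lc (derive1 phi)).
Proof.
move=> tphi; have [sphi _ _ _] := test_function_Omega tphi.
have wphi := smooth_is_weak_derivative sphi.
apply: sqint_ae (local_part_ae gamma delta (weak_derivative_ae wphi)).
  by apply: local_part_measurable => //; apply: weak_derivative_measurable; exists (derive1 phi).
by apply: L2set_measurable; exact: test_function_local_L2set.
Qed.

(** The two partial inequalities overlap at the interior point x0. *)
Lemma poincare_inequality : exists2 C : R, 0 <= C & forall phi,
  test_function Omega phi ->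
  L2ip mu phi phi <= C * energy gamma delta phi phi.
Proof.
have [C [x0 [C0 x00 x01 hC]]] := nonlocal_poincare.
have om0 : 0 < om x0 by exact: omega_gt0.
exists (C + (om x0)^-1) => [|phi tphi]; first by rewrite addr_ge0// invr_ge0 ltW.
have [sphi _ _ _] := test_function_Omega tphi.
have mphi : measurable_fun setT phi by exact: smooth_measurable.
have [_ L1 L2 _ L3] := test_function_finite_energy hgamma delta0 tphi.
have h1 := hC _ tphi; have h2 := local_poincare tphi x00 x01.
rewrite -(local_weak_derivative_test tphi) in h2.
have : (sqint mu phi <= mass_on phi `]-oo, x0[ + mass_on phi `[x0, 1%R])%E.
  rewrite (_ : sqint mu phi = mass_on phi `]-oo, +oo[); last first.
    by rewrite /mass_on set_itvNyy.
  rewrite (@mass_on_split phi -oo%O +oo%O x0)// leeD2l//.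
  rewrite !mass_onE; apply: ge0_le_integral => //.
  - by move=> x _; rewrite lee_fin mulr_ge0 ?sqr_ge0.
  - apply/measurable_EFinP; apply: measurable_funM; last exact: measurable_funX.
    exact: (measurable_indic (measurable_itv _)).
  - apply/measurable_EFinP; apply: measurable_funM; last exact: measurable_funX.
    exact: (measurable_indic (measurable_itv _)).
  - move=> x _; rewrite lee_fin; have [x1|x1] := leP x 1; last first.
      by rewrite (test_function_outside tphi) ?expr0n ?mulr0//; right; exact: ltW.
    rewrite ler_wpM2r ?sqr_ge0// !indicE ler_nat.
    have [/set_mem/=|//] := boolP (x \in _); rewrite in_itv/= andbT => x0x.
    by rewrite mem_set//= in_itv/= x0x.
move=> /le_trans/(_ (leeD h1 h2)).
rewrite /energy /nonlocal_form /local_form (sqintE L1) (sqintE L2) (sqintE L3).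
rewrite -!EFinM -EFinD lee_fin => /le_trans; apply.
have [_ _ p2] := psd_L2ip mu2; have [_ _ p1] := psd_L2ip mu.
move: (p2 _ L2) (p1 _ L3); rewrite -invr_gt0 in om0.
move: (om x0)^-1 om0 => w w0.
move: (L2ip mu2 _ _) (L2ip mu _ _) => e2 e1 e20 e10.
by nra.
Qed.

End poincare.

(** * The energy space *)

Section energy_space_facts.
Context {R : realType} (gamma : R -> R) (delta : R).
Context (hgamma : admissible_kernel gamma) (delta0 : 0 < delta).
Implicit Types (u v w phi : R -> R).
Local Notation mu := (@lebesgue_measure R).
Local Notation dom := (Omega `|` Omega_delta delta).
Local Notation FE := (finite_energy gamma delta).
Local Notation ES := (energy_space gamma delta).
Local Notation B := (energy gamma delta).
Local Notation Q := (energy_sobolev gamma delta).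
Local Notation tests := (test_function (@Omega R)).

Let sFE : subspace FE := subspace_finite_energy hgamma delta0.
Let pQ : psd_form FE Q := psd_energy_sobolev hgamma delta0.
Let pB : psd_form FE B := psd_energy hgamma delta0.
Let testFE phi (t : tests phi) : FE phi := test_function_finite_energy hgamma delta0 t.

Lemma subspace_test_function : subspace tests.
Proof.
have oO : open (@Omega R) by exact: interval_open.
have iO : is_interval (@Omega R) by exact: interval_is_interval.
have nO : @Omega R !=set0 by exists 0; apply/OmegaE; rewrite ltr01 oppr_lt0 ltr01.
split=> [|a u v tu tv]; last exact: test_function_lin.
apply: (@supported_test_function R Omega 0 0 0).
- have s := @smooth_flat R 0; have := @smooth_lin _ (-1) _ _ s s.
  by rewrite scaleN1r addNr.
- move=> x /=; rewrite in_itv/= -eq_le => /eqP <-.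
  by apply/OmegaE; rewrite ltr01 oppr_lt0 ltr01.
- by [].
Qed.

(** Some term of an approximating sequence is at finite distance of u, so u
    differs from a test function by a function of finite energy. Conversely
    density provides the sequence. *)
Lemma energy_spaceP u : ES u <-> FE u /\
  forall e : R, 0 < e -> exists2 w, tests w & Q (u - w) (u - w) < e.
Proof.
split.
  move=> [u0 Lu wu [u_ [tu]]].
  move=> /fine_cvgP[[N _ fin] cu].
  have Lmu : L2set mu u.
    suff <- : u \_ dom = u by [].
    apply/funext => x; rewrite patchE; case: ifPn => //.
    by move=> /negP xd; rewrite u0// => /mem_set.
  have FEu_ n := testFE (tu n).
  have FEw n : (N <= n)%N -> FE (u_ n - u).
    move=> Nn; have [t0 t1 _ wt _] := FEu_ n.
    have e1 : u_ n - u = -1 *: u + u_ n by rewrite scaleN1r addrC.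
    apply: (qnl_norm_finite_energy hgamma delta0).
    - by move=> x xd; rewrite e1 fct_linE u0// t0// mulr0 addr0.
    - by rewrite e1; exact: (L2set_measurable ((subspace_L2set mu).2 (-1) _ _ Lmu t1)).
    - by rewrite e1; exact: weakly_differentiable_lin.
    - by have := fin n Nn; rewrite /= => h; rewrite ltey_eq; apply/orP; left.
  have FEu : FE u.
    have -> : u = u_ N - (u_ N - u) by rewrite opprB addrCA subrr addr0.
    by apply: (subspaceB sFE); [exact: FEu_|exact: FEw].
  split => // e e0.
  have se : 0 < Num.sqrt e by rewrite sqrtr_gt0.
  have := cvgr_lt _ cu _ se.
  move=> [N' _ /(_ (maxn N N') (leq_maxr _ _))] /=.
  rewrite (qnl_norm_energy hgamma delta0 (FEw _ (leq_maxl _ _))).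
  rewrite [fine _]/= (ltr_sqrt _ e0) => h.
  exists (u_ (maxn N N')); first exact: tu.
  rewrite (psd_sqrB_sym sFE pQ FEu (FEu_ _)); exact: h.
move=> [FEu dense]; have [u0 Lu _ wu _] := FEu; split => //.
  rewrite /L2 (_ : u \_ dom = u)//.
  apply/funext => x; rewrite patchE; case: ifPn => //.
  by move=> /negP xd; rewrite u0// => /mem_set.
have /choice[u_ hu] : forall n : nat, exists w, tests w /\ Q (u - w) (u - w) < n.+1%:R^-1.
  move=> n; have [w tw Qw] := dense n.+1%:R^-1 ltac:(by rewrite invr_gt0).
  by exists w.
exists u_; split; first by move=> n; have [] := hu n.
have FEu_ n : FE (u_ n) by apply: testFE; have [] := hu n.
have -> : (fun n => qnl_norm gamma delta (u_ n \- u)) =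
    (fun n => (Num.sqrt (Q (u_ n - u) (u_ n - u)))%:E).
  apply/funext => n.
  by rewrite -(qnl_norm_energy hgamma delta0 (subspaceB sFE (FEu_ n) FEu)).
apply: cvg_EFin; first by apply: nearW.
rewrite -[X in _ --> X](@sqrtr0 R).
apply: continuous_cvg; first exact: sqrt_continuous.
apply: (@squeeze_cvgr _ _ _ _ (cst 0) (@harmonic R)); last 2 first.
- exact: cvg_cst.
- exact: cvg_harmonic.
apply: nearW => n /=; have [_ /ltW h] := hu n.
rewrite (psd_sqrB_sym sFE pQ (FEu_ n) FEu) h andbT.
exact: (psd_ge0 pQ (subspaceB sFE FEu (FEu_ n))).
Qed.

Lemma energy_space_finite_energy u : ES u -> FE u.
Proof. by case/energy_spaceP. Qed.

Lemma test_function_energy_space phi : tests phi -> ES phi.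
Proof.
move=> tphi; apply/energy_spaceP; split => [|e e0]; first exact: testFE.
by exists phi => //; rewrite subrr (psd_form0 sFE pQ).
Qed.

Lemma subspace_energy_space : subspace ES.
Proof.
split; first exact: test_function_energy_space subspace_test_function.1.
move=> a u v /energy_spaceP[FEu du] /energy_spaceP[FEv dv].
apply/energy_spaceP; split=> [|e e0]; first exact: sFE.2.
(* For the approximations w of u and z of v, the squared distance from
   a u + v to a w + z is at most 2 (a^2 + 1) times their precision. *)
have a1 : 0 < 4 * (a ^+ 2 + 1) by have := sqr_ge0 a; lra.
have e1 : 0 < e / (4 * (a ^+ 2 + 1)) by rewrite divr_gt0.
have [w tw Qw] := du _ e1; have [z tz Qz] := dv _ e1.
exists (a *: w + z); first exact: subspace_test_function.2.
have -> : a *: u + v - (a *: w + z) = a *: (u - w) + (v - z).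
  by rewrite scalerBr addrACA opprD.
have FEw := subspaceB sFE FEu (testFE tw); have FEz := subspaceB sFE FEv (testFE tz).
apply: le_lt_trans (psd_sqrD_le sFE pQ (subspaceZ a sFE FEw) FEz) _.
rewrite (psd_sqrZ sFE pQ)//; move: (Q (u - w) _) (Q (v - z) _) Qw Qz => p q.
rewrite !ltr_pdivlMr// => pe qe.
have : a ^+ 2 * (p * (4 * (a ^+ 2 + 1))) <= a ^+ 2 * e.
  by rewrite ler_wpM2l ?sqr_ge0 ?ltW.
move: (a ^+ 2) (sqr_ge0 a) a1 pe qe => b b0 a1 pe qe h.
rewrite -(ltr_pM2r a1); nra.
Qed.

Lemma energy_le_sobolev u : FE u -> B u u <= Q u u.
Proof.
move=> FEu; rewrite /Q lerDr.
exact: (psd_ge0 (psd_L2ip_finite_energy gamma delta) FEu).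
Qed.

(** The Poincare inequality extends from the test functions to their closure;
    the factor 4 comes from using twice that |a + b|^2 <= 2 |a|^2 + 2 |b|^2. *)
Lemma energy_sobolev_le_energy :
  exists2 C : R, 0 < C & forall u, ES u -> Q u u <= C * B u u.
Proof.
have [C C0 hC] := poincare_inequality hgamma delta0.
exists (4 * (C + 1)); first lra.
move=> u /energy_spaceP[FEu du]; rewrite -subr_le0.
apply: (@le_inv_cvg0 _ _ (2 + 4 * (C + 1))) => [|n]; first lra.
have [w tw] := du n.+1%:R^-1 ltac:(by rewrite invr_gt0).
have FEw := testFE tw; have FEuw := subspaceB sFE FEu FEw.
have h1 : Q u u <= 2 * Q (u - w) (u - w) + 2 * Q w w.
  by rewrite -{1 2}(subrK w u); exact: (psd_sqrD_le sFE pQ FEuw FEw).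
have h2 : B w w <= 2 * B (u - w) (u - w) + 2 * B u u.
  rewrite (psd_sqrB_sym sFE pB FEu FEw) -{1 2}(subrK u w).
  exact: (psd_sqrD_le sFE pB (subspaceB sFE FEw FEu) FEu).
have h3 : Q w w <= (C + 1) * B w w.
  by rewrite /energy_sobolev mulrDl mul1r lerD2r; exact: hC.
have h4 := energy_le_sobolev FEuw.
move: h1 h2 h3 h4.
move: (Q u u) (Q (u - w) _) (Q w w) (B w w) (B u u) (B (u - w) _).
move=> q1 q2 q3 b1 b2 b3 h1 h2 h3 h4 h5.
have h6 : (C + 1) * b1 <= (C + 1) * (2 * b3 + 2 * b2) by rewrite ler_wpM2l// addr_ge0.
have h7 : (C + 1) * b3 <= (C + 1) * n.+1%:R^-1.
  by rewrite ler_wpM2l ?addr_ge0// (le_trans h4)// ltW.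
move: (n.+1%:R^-1 : R) h5 h7 => r h5 h7; nra.
Qed.

End energy_space_facts.

(** * Completeness *)

Section completeness.
Context {R : realType} (gamma : R -> R) (delta : R).
Context (hgamma : admissible_kernel gamma) (delta0 : 0 < delta).
Implicit Types (u v w f g phi : R -> R).
Local Notation mu := (@lebesgue_measure R).
Local Notation mu2 := (mu \x mu)%E.
Local Notation om := (omega_delta gamma delta).
Local Notation wd := (weak_derivative half_line).
Local Notation nl := (nonlocal_part gamma delta).
Local Notation lc := (local_part gamma delta).
Local Notation FE := (finite_energy gamma delta).
Local Notation Q := (energy_sobolev gamma delta).
Local Notation tests := (test_function (@Omega R)).

Let sFE : subspace FE := subspace_finite_energy hgamma delta0.
Let pQ : psd_form FE Q := psd_energy_sobolev hgamma delta0.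
Let testFE phi (t : tests phi) : FE phi := test_function_finite_energy hgamma delta0 t.
Let sL2 := subspace_L2set mu.
Let pL2 := psd_L2ip mu.

Lemma L2set_locally_integrable u : L2set mu u -> locally_integrable half_line u.
Proof.
move=> Lu; split; [|exact: open_half_line|].
  by apply: measurable_funS (L2set_measurable Lu).
move=> K _ cK.
have := L2set_integrable Lu (compact_measurable cK) (compact_finite_measure cK).
by case/integrableP.
Qed.

Definition inv_sqrt_omega (x : R) := (Num.sqrt (om x))^-1.

Lemma sqrt_omega_gt0 (x : R) : 0 < x -> 0 < Num.sqrt (om x).
Proof. by move=> x0; rewrite sqrtr_gt0; exact: omega_gt0. Qed.

Lemma inv_sqrt_omega_homo (x y : R) : 0 < x -> x <= y ->
  inv_sqrt_omega y <= inv_sqrt_omega x.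
Proof.
move=> x0 xy; have y0 := lt_le_trans x0 xy.
rewrite /inv_sqrt_omega lef_pV2 ?posrE; [|exact: sqrt_omega_gt0|exact: sqrt_omega_gt0].
rewrite (ler_sqrt _ (ltW (omega_gt0 hgamma delta0 y0))).
exact: omega_homo.
Qed.

Lemma inv_sqrt_omega_measurable : measurable_fun half_line inv_sqrt_omega.
Proof.
apply: nonincreasing_in_measurable; first exact: is_interval_half_line.
by move=> x y /half_lineE x0 _ xy; exact: inv_sqrt_omega_homo.
Qed.

Lemma local_part_inv_sqrt_omega g x : half_line x ->
  g x = inv_sqrt_omega x * lc g x.
Proof.
move=> xh; rewrite /local_part patchE mem_set// mulrA mulVf ?mul1r//.
by rewrite gt_eqF// sqrt_omega_gt0//; exact/half_lineE.
Qed.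

(** On a compact subset of the half line with least element a, the function g
    is at most a constant times its local part, as the weight is at least its
    value at a. *)
Lemma local_part_locally_integrable g : measurable_fun half_line g ->
  L2set mu (lc g) -> locally_integrable half_line g.
Proof.
move=> mg Lg; split; [exact: mg|exact: open_half_line|].
move=> K KH cK; have mK := compact_measurable cK.
have [K0|/set0P K0] := eqVneq K set0; first by rewrite K0 integral_set0.
have cid : {within K, continuous (@id R)}.
  by apply: continuous_subspaceT => x; exact: cvg_id.
have [a /set_mem Ka mina] := compact_EVT_min K0 cK cid.
have a0 : 0 < a by apply/half_lineE; exact: KH.
suff : mu.-integrable K (EFin \o g) by case/integrableP.
have := L2set_integrable (subspaceZ (inv_sqrt_omega a) sL2 Lg) mK
  (compact_finite_measure cK).
apply: le_integrable => //.
  by apply/measurable_EFinP; apply: measurable_funS mg => //; exact: half_line_measurable.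
move=> x Kx; have xH := KH _ Kx; have ax : a <= x by apply: mina; exact: mem_set.
rewrite /= lee_fin {1}(local_part_inv_sqrt_omega g xH).
have p0 y : 0 <= inv_sqrt_omega y by rewrite /inv_sqrt_omega invr_ge0 sqrtr_ge0.
have le_norm (p q r : R) : 0 <= p -> p <= q -> `|p * r| <= `|q * r|.
  by move=> p0' pq; rewrite !normrM ler_wpM2r// !ger0_norm// (le_trans p0').
exact: (le_norm _ (inv_sqrt_omega a) _ (p0 x) (inv_sqrt_omega_homo a0 ax)).
Qed.

(** Dividing by the square root of the weight turns the pairing with g into an
    inner product with the local part of g ([pairing_weighted]). *)
Definition weighted phi : R -> R := (fun x => inv_sqrt_omega x * phi x) \_ half_line.

Lemma pairing_weighted g phi :
  \int[mu]_(x in half_line) (g x * phi x) = L2ip mu (lc g) (weighted phi).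
Proof.
rewrite Rintegral_mkcond; apply: eq_Rintegral => x _.
rewrite /weighted !patchE; case: ifPn => [/set_mem xH|_]; last by rewrite mulr0.
by rewrite {1}(local_part_inv_sqrt_omega g xH); ring.
Qed.

Lemma pairing_half_line w phi : (forall x, ~ half_line x -> phi x = 0) ->
  \int[mu]_(x in half_line) (w x * phi x) = L2ip mu w phi.
Proof.
move=> phi0; rewrite Rintegral_mkcond; apply: eq_Rintegral => x _.
rewrite patchE; case: ifPn => // /negP xH.
by rewrite phi0 ?mulr0// => /mem_set.
Qed.

Lemma supported_L2set f a b (M : R) : measurable_fun setT f ->
  (forall x, `|f x| <= M) -> supported_in a b f -> L2set mu f.
Proof.
move=> mf fM sup; have cab := @segment_compact R a b.
apply: (bounded_L2set _ (compact_finite_measure cab) mf fM).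
  exact: compact_measurable cab.
move=> x; rewrite /= in_itv/= => /negP; rewrite negb_and -!ltNge => xab.
by apply: sup; case/orP: xab => /ltW; [left|right].
Qed.

Lemma weighted_L2set phi : test_function half_line phi -> L2set mu (weighted phi).
Proof.
move=> /test_function_half_line[sphi cphi _ [a [b [a0 _ _ sup _]]]].
have [M M0 hM] := supported_bounded cphi sup.
have sup' : supported_in a b (weighted phi).
  by move=> x xab; rewrite /weighted patchE; case: ifPn => // _; rewrite sup ?mulr0.
apply: (@supported_L2set _ a b (inv_sqrt_omega a * M)) => //.
  apply/(measurable_restrictT _ half_line_measurable)/measurable_funM.
    exact: inv_sqrt_omega_measurable.
  exact: smooth_measurable.
have p0 x : 0 <= inv_sqrt_omega x by rewrite invr_ge0 sqrtr_ge0.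
move=> x; have [xa|ax] := leP x a.
  by rewrite sup' ?normr0 ?mulr_ge0//; left.
rewrite /weighted patchE mem_set; last by apply/half_lineE; exact: lt_trans ax.
rewrite normrM; apply: ler_pM; [exact: normr_ge0|exact: normr_ge0| |exact: hM].
by rewrite (ger0_norm (p0 x)); apply: inv_sqrt_omega_homo a0 (ltW ax).
Qed.

(** By Cauchy-Schwarz, both sides of the integration by parts formula are
    continuous in the L2 norms of u and of the local part of its derivative. *)
Lemma is_weak_derivative_limit u g (u_ : nat -> R -> R) (c : R) :
  L2set mu u -> measurable_fun half_line g -> L2set mu (lc g) ->
  (forall n, FE (u_ n)) ->
  (forall n : nat, L2ip mu (u - u_ n) (u - u_ n) <= c / n.+1%:R) ->
  (forall n : nat, L2ip mu (lc g - lc (wd (u_ n))) (lc g - lc (wd (u_ n))) <=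
     c / n.+1%:R) ->
  is_weak_derivative half_line u g.
Proof.
move=> Lu mg Lg FEu_ hu hg; split; first exact: L2set_locally_integrable.
  exact: local_part_locally_integrable.
move=> phi tphi.
have [sphi cphi cphi' [a [b [a0 ab abD sup sup']]]] := test_function_half_line tphi.
have Lw := weighted_L2set tphi.
have Lp : L2set mu (derive1 phi).
  have [M M0 hM] := supported_bounded cphi' sup'.
  apply: (supported_L2set _ hM sup').
  by apply: smooth_measurable; exact: smooth_derive1.
have phi'0 x : ~ half_line x -> derive1 phi x = 0.
  move=> xH; apply: sup'; left; rewrite leNgt; apply/negP => ax.
  by apply: xH; apply/half_lineE; exact: lt_trans ax.
have CS := psd_cauchy_schwarz sL2 pL2.
rewrite (pairing_half_line _ phi'0) pairing_weighted.
apply/eqP; rewrite -addr_eq0 -sqrf_eq0 eq_le sqr_ge0 andbT.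
(* The hypotheses at n = 0 bound a square by c. *)
have c0 : 0 <= c.
  have [_ L0 _ _ _] := FEu_ 0%N; have := hu 0%N; rewrite divr1; apply: le_trans.
  by apply: (psd_ge0 pL2); exact: subspaceB.
pose A := L2ip mu (derive1 phi) (derive1 phi); pose W := L2ip mu (weighted phi) (weighted phi).
have A0 : 0 <= A by exact: (psd_ge0 pL2).
have W0 : 0 <= W by exact: (psd_ge0 pL2).
apply: (@le_inv_cvg0 _ _ (2 * (c * A + c * W))) => [|n].
  by rewrite mulr_ge0// addr_ge0// mulr_ge0.
have [_ Ln _ wn Lhn] := FEu_ n.
have := weak_derivativeP wn; move=> [_ _ /(_ _ tphi)].
rewrite (pairing_half_line _ phi'0) pairing_weighted => /eqP; rewrite -addr_eq0 => /eqP eqn.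
have -> : L2ip mu u (derive1 phi) + L2ip mu (lc g) (weighted phi) =
    L2ip mu (u - u_ n) (derive1 phi) -
    - L2ip mu (lc g - lc (wd (u_ n))) (weighted phi).
  rewrite (psd_formBl pL2 Lu Ln Lp) (psd_formBl pL2 Lg Lhn Lw).
  move: eqn.
  move: (L2ip mu u _) (L2ip mu (lc g) _) (L2ip mu (u_ n) _) (L2ip mu (lc _) _).
  by move=> p q r s /eqP; rewrite addr_eq0 => /eqP ->; ring.
apply: (le_trans (sqrB_le _ _)); rewrite sqrrN -mulrDr -mulrA ler_wpM2l// mulrDl.
apply: lerD.
  apply: le_trans (CS _ _ (subspaceB sL2 Lu Ln) Lp) _.
  by rewrite mulrAC ler_wpM2r.
apply: le_trans (CS _ _ (subspaceB sL2 Lg Lhn) Lw) _.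
by rewrite mulrAC ler_wpM2r.
Qed.

Lemma energy_sobolev_parts w : FE w ->
  [/\ (sqint mu w <= (Q w w)%:E)%E, (sqint mu2 (nl w) <= (Q w w)%:E)%E &
      (sqint mu (lc (wd w)) <= (Q w w)%:E)%E].
Proof.
move=> [_ w1 w2 _ w3]; rewrite (sqintE w1) (sqintE w2) (sqintE w3) !lee_fin.
have [_ _ p] := pL2; have [_ _ p'] := psd_L2ip mu2.
move: (p _ w1) (p _ w3) (p' _ w2).
rewrite /energy_sobolev /energy /nonlocal_form /local_form.
move: (L2ip mu w w) (L2ip mu _ _) (L2ip mu2 _ _) => a b c a0 b0 c0.
by split; lra.
Qed.

Lemma local_weak_derivative_sub v w : FE v -> FE w ->
  {ae mu, forall x, lc (wd (v - w)) x = (lc (wd v) \- lc (wd w)) x}.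
Proof.
move=> [_ _ _ wv _] [_ _ _ ww _].
rewrite addrC -scaleN1r; have := local_weak_derivative_lin gamma delta (-1) ww wv.
apply: (@filterS _ _ (ae_filter_ringOfSetsType mu)) => x ->.
by rewrite fct_linE mulN1r addrC.
Qed.

Lemma fast_subsequence (K : R) : 0 <= K -> exists k_ : nat -> nat,
  (forall k, (k <= k_ k)%N) /\
  forall k : nat, 4 ^+ k * (K / (k_ k.+1).+1%:R + K / (k_ k).+1%:R) <=
    1 / (2 ^ (k + 1))%:R.
Proof.
move=> K0; pose b := (Num.bound K).+1.
have Kb : K <= b%:R.
  by apply/ltW/(lt_trans (archi_boundP K0)); rewrite ltr_nat.
(* Both quotients by these indices are at most 1 / (4 8^k), which is
   1 / (2^(k + 2) 4^k). *)
exists (fun k => 4 * 8 ^ k * b)%N; split=> [k|k].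
  apply: (@leq_trans (8 ^ k)); first by apply: ltnW; exact: ltn_expl.
  by rewrite -mulnA mulnCA leq_pmulr.
have step j : (k <= j)%N -> K / (4 * 8 ^ j * b).+1%:R <= (4 * 8 ^+ k)^-1.
  move=> kj; rewrite ler_pdivrMr ?ltr0n// ler_pdivlMl ?mulr_gt0 ?exprn_gt0//.
  apply: (@le_trans _ _ (4 * 8 ^ j * b)%:R); last by rewrite ler_nat.
  rewrite !natrM natrX ler_pM ?mulr_ge0 ?exprn_ge0// ler_wpM2l//.
  by rewrite ler_weXn2l// ler1n.
apply: (@le_trans _ _ (4 ^+ k * ((4 * 8 ^+ k)^-1 + (4 * 8 ^+ k)^-1))).
  by rewrite ler_wpM2l ?exprn_ge0// lerD// step.
rewrite natrX addn1 exprS (_ : 8 = 4 * 2 :> R); last by ring.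
rewrite exprMn le_eqVlt; apply/orP; left; apply/eqP; field.
by rewrite !expf_neq0.
Qed.

(** The limit is cut to 0 outside Omega, where all the terms vanish, and the
    derivative g is obtained from the limit of the local parts. Each of the
    three parts of the squared distance from u_n to the limit is at most
    2 K / (n + 1) by Fatou's lemma. *)
Lemma energy_sobolev_complete (u_ : nat -> R -> R) (K : R) : 0 <= K ->
  (forall n, tests (u_ n)) ->
  (forall m n : nat, Q (u_ m - u_ n) (u_ m - u_ n) <= K / m.+1%:R + K / n.+1%:R) ->
  exists u, [/\ FE u, forall x, ~ Omega x -> u x = 0 &
    forall n : nat, Q (u_ n - u) (u_ n - u) <= 6 * K / n.+1%:R].
Proof.
move=> K0 tu cauchy.
have FEu_ n : FE (u_ n) by exact: testFE.
have Lu_ n : L2set mu (u_ n) by case: (FEu_ n).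
have mu_n n : measurable_fun setT (u_ n) by exact: (L2set_measurable (Lu_ n)).
have Ln_ n : L2set mu2 (nl (u_ n)) by case: (FEu_ n).
have Lh_ n : L2set mu (lc (wd (u_ n))) by case: (FEu_ n).
have mh v : FE v -> measurable_fun setT (lc (wd v)).
  by case=> _ _ _ wv _; exact: local_part_measurable (weak_derivative_measurable wv).
have mh_ n : measurable_fun setT (lc (wd (u_ n))) by exact: mh.
have FEB m n : FE (u_ m - u_ n) by exact: (subspaceB sFE).
have hB m n : (sqint mu (lc (wd (u_ m)) \- lc (wd (u_ n)))%R <=
    (Q (u_ m - u_ n) (u_ m - u_ n))%:E)%E.
  have [_ _] := energy_sobolev_parts (FEB m n); apply: le_trans.
  rewrite (sqint_ae _ _ (local_weak_derivative_sub (FEu_ m) (FEu_ n)))//.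
    exact: mh.
  by apply: measurable_funB; exact: mh_.
have [k_ [k_ge k_fast]] := fast_subsequence K0.
pose v k := u_ (k_ k).
have fast (e : nat -> \bar R) : (forall k, (e k <= (Q (v k.+1 - v k) (v k.+1 - v k))%:E)%E) ->
    forall k : nat, ((4 ^+ k)%:E * e k <= (1 / (2 ^ (k + 1))%:R)%:E)%E.
  move=> he k; apply: (@le_trans _ _ ((4 ^+ k)%:E * (Q (v k.+1 - v k) (v k.+1 - v k))%:E)%E).
    by rewrite lee_wpmul2l// lee_fin exprn_ge0.
  rewrite -EFinM lee_fin; apply: le_trans (k_fast k).
  by apply: ler_wpM2l; [exact: exprn_ge0|exact: cauchy].
have [f mf cf] : exists2 f : R -> R, measurable_fun setT f &
    {ae mu, forall x, v ^~ x @ \oo --> f x}.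
  apply: (@L2_fast_cauchy_ae _ _ _ mu v) => [n|]; first exact: (L2set_measurable (Lu_ _)).
  by apply: fast => k; have [] := energy_sobolev_parts (FEB (k_ k.+1) (k_ k)).
have [G mG cG] : exists2 G : R -> R, measurable_fun setT G &
    {ae mu, forall x, (fun k => lc (wd (v k)) x) @ \oo --> G x}.
  apply: (@L2_fast_cauchy_ae _ _ _ mu (fun k => lc (wd (v k)))) => [n|].
    exact: L2set_measurable (Lh_ _).
  by apply: fast => k; exact: hB.
pose u : R -> R := f \_ Omega.
pose g x := inv_sqrt_omega x * G x.
have u0 x : ~ Omega x -> u x = 0.
  by move=> xO; rewrite /u patchE memNset.
have mu_ : measurable_fun setT u.
  apply/(measurable_restrictT _ (@Omega_measurable R)).
  exact: measurable_funS mf.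
have mg : measurable_fun half_line g.
  apply: measurable_funM; first exact: inv_sqrt_omega_measurable.
  exact: measurable_funS mG.
have mlg : measurable_fun setT (lc g) by exact: local_part_measurable.
have vout k x : ~ Omega x -> v k x = 0 by exact: (test_function_notin (tu _)).
have cu : {ae mu, forall x, v ^~ x @ \oo --> u x}.
  apply: (@filterS _ _ (ae_filter_ringOfSetsType mu)) cf => x fx.
  have [xO|xO] := pselect (Omega x); first by rewrite /u patchE mem_set.
  rewrite (u0 _ xO) (_ : v ^~ x = fun=> 0); first exact: cvg_cst.
  by apply/funext => k; exact: vout.
have ch : {ae mu, forall x, (fun k => lc (wd (v k)) x) @ \oo --> lc g x}.
  apply: (@filterS _ _ (ae_filter_ringOfSetsType mu)) cG => x Gx.
  have [xH|xH] := pselect (half_line x); last first.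
    rewrite {2}/local_part patchE memNset// (_ : (fun k => _) = fun=> 0).
      exact: cvg_cst.
    by apply/funext => k; rewrite /local_part patchE memNset.
  suff -> : lc g x = G x by [].
  have p0 : inv_sqrt_omega x != 0.
    by rewrite /inv_sqrt_omega invr_eq0 gt_eqF// sqrt_omega_gt0//; exact/half_lineE.
  by apply: (mulfI p0); rewrite -local_part_inv_sqrt_omega.
have cn : {ae mu2, forall p, (fun k => nl (v k) p) @ \oo --> nl u p}.
  apply: (@filterS _ _ (ae_filter_ringOfSetsType mu2)) (ae_product cu) => p [c1 c2].
  have [pR|pR] := pselect (@nonlocal_region R p); last first.
    rewrite {2}/nonlocal_part patchE memNset// (_ : (fun k => _) = fun=> 0).
      exact: cvg_cst.
    by apply/funext => k; rewrite /nonlocal_part patchE memNset.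
  rewrite {2}/nonlocal_part patchE mem_set//.
  rewrite (_ : (fun k => _) = fun k =>
    Num.sqrt (gamma_delta gamma delta (p.2 - p.1)) * (v k p.2 - v k p.1)); last first.
    by apply/funext => k; rewrite /nonlocal_part patchE mem_set.
  by apply: cvgM; [exact: cvg_cst|exact: cvgB].
have Qn n : \forall k \near \oo,
    ((Q (v k - u_ n) (v k - u_ n))%:E <= (2 * K / n.+1%:R)%:E)%E.
  exists n => // k /= nk; rewrite lee_fin; apply: (le_trans (cauchy _ _)).
  have -> : 2 * K / n.+1%:R = K / n.+1%:R + K / n.+1%:R by ring.
  rewrite lerD2r ler_wpM2l// lef_pV2 ?posrE ?ltr0n// ler_nat ltnS.
  exact: leq_trans nk (k_ge k).
have s1 n : (sqint mu (u \- u_ n)%R <= (2 * K / n.+1%:R)%:E)%E.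
  apply: (@sqint_fatou _ _ _ mu (fun k => v k \- u_ n)).
  - by move=> k; apply: measurable_funB; exact: mu_n.
  - by apply: measurable_funB => //; exact: mu_n.
  - apply: (@filterS _ _ (ae_filter_ringOfSetsType mu)) cu => x cx.
    by apply: cvgB => //; exact: cvg_cst.
  - apply: filterS (Qn n) => k; apply: le_trans.
    by have [] := energy_sobolev_parts (FEB (k_ k) n).
have s3 n : (sqint mu (lc g \- lc (wd (u_ n)))%R <= (2 * K / n.+1%:R)%:E)%E.
  apply: (@sqint_fatou _ _ _ mu (fun k => lc (wd (v k)) \- lc (wd (u_ n)))).
  - by move=> k; apply: measurable_funB; exact: mh_.
  - by apply: measurable_funB => //; exact: mh_.
  - apply: (@filterS _ _ (ae_filter_ringOfSetsType mu)) ch => x cx.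
    by apply: cvgB => //; exact: cvg_cst.
  - apply: filterS (Qn n) => k; apply: le_trans; exact: hB.
have nlB v1 v2 : nl (v1 - v2) = nl v1 \- nl v2.
  rewrite addrC -scaleN1r nonlocal_part_lin; apply/funext => p.
  by rewrite fct_linE mulN1r addrC.
have s2 n : (sqint mu2 (nl u \- nl (u_ n))%R <= (2 * K / n.+1%:R)%:E)%E.
  apply: (@sqint_fatou _ _ _ mu2 (fun k => nl (v k) \- nl (u_ n))).
  - move=> k; rewrite -nlB; apply: (nonlocal_part_measurable hgamma delta0).
    by apply: measurable_funB; exact: mu_n.
  - rewrite -nlB; apply: (nonlocal_part_measurable hgamma delta0).
    by apply: measurable_funB => //; exact: mu_n.
  - apply: (@filterS _ _ (ae_filter_ringOfSetsType mu2)) cn => x cx.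
    by apply: cvgB => //; exact: cvg_cst.
  - apply: filterS (Qn n) => k; apply: le_trans; rewrite -nlB.
    by have [] := energy_sobolev_parts (FEB (k_ k) n).
have L1 n : L2set mu (u - u_ n).
  apply/L2setP; split; last exact: le_lt_trans (s1 n) (ltry _).
  by apply: measurable_funB => //; exact: mu_n.
have L3 n : L2set mu (lc g - lc (wd (u_ n))).
  apply/L2setP; split; last exact: le_lt_trans (s3 n) (ltry _).
  by apply: measurable_funB => //; exact: mh_.
have L2' n : L2set mu2 (nl u - nl (u_ n)).
  apply/L2setP; split; last exact: le_lt_trans (s2 n) (ltry _).
  rewrite -[nl u - nl (u_ n)]/(nl u \- nl (u_ n)) -nlB.
  apply: (nonlocal_part_measurable hgamma delta0).
  by apply: measurable_funB => //; exact: mu_n.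
have Lu : L2set mu u by rewrite -(subrK (u_ 0%N) u); exact: (subspaceD sL2).
have Llg : L2set mu (lc g).
  by rewrite -(subrK (lc (wd (u_ 0%N))) (lc g)); exact: (subspaceD sL2).
have Lnu : L2set mu2 (nl u).
  by rewrite -(subrK (nl (u_ 0%N)) (nl u)); exact: (subspaceD (subspace_L2set mu2)).
have wug : is_weak_derivative half_line u g.
  apply: (is_weak_derivative_limit (c := 2 * K) Lu mg Llg FEu_) => n.
    by rewrite -lee_fin -(sqintE (L1 n)); exact: s1.
  by rewrite -lee_fin -(sqintE (L3 n)); exact: s3.
have wu : weakly_differentiable half_line u by exists g.
have hg := local_part_ae gamma delta (weak_derivative_ae wug).
have FEu : FE u.
  split => //; last first.
    by apply: L2set_ae hg Llg; exact: local_part_measurable (weak_derivative_measurable wu).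
  by move=> x xd; apply: u0 => xO; apply: xd; left.
exists u; split => // n.
rewrite (psd_sqrB_sym sFE pQ (FEu_ n) FEu).
have FEd : FE (u - u_ n) := subspaceB sFE FEu (FEu_ n).
have [_ d1 d2 _ d3] := FEd.
have e3 : sqint mu (lc (wd (u - u_ n))) = sqint mu (lc g \- lc (wd (u_ n))).
  have md : measurable_fun setT (lc g \- lc (wd (u_ n))).
    by apply: measurable_funB => //; exact: mh_.
  apply: sqint_ae; [exact: mh|exact: md|].
  apply: (@filterS2 _ _ (ae_filter_ringOfSetsType mu)) hg
    (local_weak_derivative_sub FEu (FEu_ n)) => x hgx ->.
  by rewrite /= hgx.
have q1 : L2ip mu (u - u_ n) (u - u_ n) <= 2 * K / n.+1%:R.
  by rewrite -lee_fin -(sqintE d1); exact: s1.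
have q2 : L2ip mu2 (nl (u - u_ n)) (nl (u - u_ n)) <= 2 * K / n.+1%:R.
  by rewrite -lee_fin -(sqintE d2) nlB; exact: s2.
have q3 : L2ip mu (lc (wd (u - u_ n))) (lc (wd (u - u_ n))) <= 2 * K / n.+1%:R.
  by rewrite -lee_fin -(sqintE d3) e3; exact: s3.
rewrite /energy_sobolev /energy /nonlocal_form /local_form.
have -> : 6 * K / n.+1%:R =
    2 * K / n.+1%:R + (2 * K / n.+1%:R + 2 * K / n.+1%:R) by ring.
by apply: lerD q1 _; exact: lerD.
Qed.

End completeness.

(** * Well-posedness *)

Section well_posedness.
Context {R : realType} (gamma : R -> R) (delta : R).
Context (hgamma : admissible_kernel gamma) (delta0 : 0 < delta).
Implicit Types (u v w f : R -> R) (F : (R -> R) -> R).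
Local Notation mu := (@lebesgue_measure R).
Local Notation FE := (finite_energy gamma delta).
Local Notation ES := (energy_space gamma delta).
Local Notation B := (energy gamma delta).
Local Notation Q := (energy_sobolev gamma delta).
Local Notation tests := (test_function (@Omega R)).

Let sFE : subspace FE := subspace_finite_energy hgamma delta0.
Let pQ : psd_form FE Q := psd_energy_sobolev hgamma delta0.
Let pB : psd_form FE B := psd_energy hgamma delta0.
Let sES : subspace ES := subspace_energy_space hgamma delta0.
Let FES u (Eu : ES u) : FE u := energy_space_finite_energy hgamma delta0 Eu.

Lemma qnl_norm_energy_space u : ES u ->
  qnl_norm gamma delta u = (Num.sqrt (Q u u))%:E.
Proof. by move=> Eu; exact: (qnl_norm_energy hgamma delta0 (FES Eu)). Qed.

Lemma energy_space_complete (C : R) (u_ : nat -> R -> R) : 0 < C ->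
  (forall u, ES u -> Q u u <= C * B u u) -> (forall n, tests (u_ n)) ->
  (forall m n : nat, B (u_ m - u_ n) (u_ m - u_ n) <= 2 / m.+1%:R + 2 / n.+1%:R) ->
  exists u, [/\ ES u, forall x, ~ Omega x -> u x = 0 & forall e : R, 0 < e ->
    exists N, forall n, (N <= n)%N -> B (u_ n - u) (u_ n - u) < e].
Proof.
move=> C0 hC tu cauchy; have K0 : 0 <= 2 * C by rewrite mulr_ge0// ltW.
have Eu_ n : ES (u_ n) := test_function_energy_space hgamma delta0 (tu n).
have [|u [FEu u0 cu]] := energy_sobolev_complete hgamma delta0 K0 tu.
  move=> m n; apply: le_trans (hC _ (subspaceB sES (Eu_ m) (Eu_ n))) _.
  have -> : 2 * C / m.+1%:R + 2 * C / n.+1%:R = C * (2 / m.+1%:R + 2 / n.+1%:R).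
    by ring.
  exact: ler_wpM2l (ltW C0) _ _ (cauchy m n).
have c0 : 0 <= 6 * (2 * C) by rewrite mulr_ge0.
have Eu : ES u.
  apply/(energy_spaceP hgamma delta0); split => // e e0.
  have [N hN] := div_succ_lt c0 e0; exists (u_ N); first exact: tu.
  rewrite (psd_sqrB_sym sFE pQ FEu (FES (Eu_ N))).
  exact: le_lt_trans (cu N) (hN _ (leqnn _)).
exists u; split => // e e0; have [N hN] := div_succ_lt c0 e0.
exists N => n Nn; apply: le_lt_trans (hN n Nn).
apply: le_trans (cu n).
exact: (energy_le_sobolev (subspaceB sFE (FES (Eu_ n)) FEu)).
Qed.

(** Coercivity makes F bounded for the energy, and the minimisation takes place
    among test functions. *)
Lemma variational_existence F : bounded_linear_functional gamma delta F ->
  exists u, [/\ ES u, forall x, ~ Omega x -> u x = 0 &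
    forall v, ES v -> B u v = F v].
Proof.
move=> [lF [M FM]]; have [C C0 hC] := energy_sobolev_le_energy hgamma delta0.
apply: (@riesz_representation R _ ES tests B F
  [set u | forall x, ~ Omega x -> u x = 0] (M ^+ 2 * C)).
- exact: sES.
- exact: subspace_test_function.
- by move=> phi; exact: test_function_energy_space.
- exact: psd_formS FES pB.
- exact: lF.
- by rewrite mulr_ge0 ?sqr_ge0// ltW.
- move=> v Ev; have := FM v Ev; rewrite (qnl_norm_energy_space Ev) -EFinM lee_fin.
  have Q0 := psd_ge0 pQ (FES Ev).
  move=> FMv; apply: (@le_trans _ _ (M ^+ 2 * Q v v)); last first.
    by rewrite -mulrA; apply: ler_wpM2l; [exact: sqr_ge0|exact: hC].
  rewrite -[in leRHS](sqr_sqrtr Q0) -exprMn -(real_normK (num_real (F v))).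
  by apply: lerXn2r => //; rewrite nnegrE//; exact: le_trans FMv.
- move=> v Ev e e0; have [_ dense] := (energy_spaceP hgamma delta0 v).1 Ev.
  have [w tw Qw] := dense e e0; exists w; first exact: tw.
  apply: le_lt_trans Qw; apply: energy_le_sobolev.
  exact: (subspaceB sFE (FES Ev) (test_function_finite_energy hgamma delta0 tw)).
- by move=> u_ tu cauchy; exact: (energy_space_complete C0 hC tu cauchy).
Qed.

(** F is evaluated on u divided by its norm, unless this norm is 0. *)
Lemma dual_norm_bound F (C : R) u : 0 < C ->
  bounded_linear_functional gamma delta F -> ES u -> Q u u <= C * F u ->
  (qnl_norm gamma delta u <= C%:E * dual_norm gamma delta F)%E.
Proof.
move=> C0 [lF _] Eu QF; rewrite (qnl_norm_energy_space Eu).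
have Q0 := psd_ge0 pQ (FES Eu).
have dualP v : ES v -> Q v v <= 1 -> (`|F v|%:E <= dual_norm gamma delta F)%E.
  move=> Ev Qv; apply: ereal_sup_ubound; exists v => //; split => //.
  by rewrite (qnl_norm_energy_space Ev) lee_fin -[leRHS]sqrtr1 ler_sqrt.
have dual0 : (0 <= dual_norm gamma delta F)%E.
  apply: le_trans (dualP 0 sES.1 _); first by rewrite lee_fin.
  by rewrite (psd_form0 sFE pQ) ler01.
have [->|q0] := eqVneq (Num.sqrt (Q u u)) 0.
  by apply: mule_ge0 => //; rewrite lee_fin ltW.
have q_gt0 : 0 < Num.sqrt (Q u u) by rewrite lt_def q0 sqrtr_ge0.
have Qq := sqr_sqrtr Q0.
have Fv := functionalZ (Num.sqrt (Q u u))^-1 sES lF Eu.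
have Qv := psd_sqrZ sFE pQ (Num.sqrt (Q u u))^-1 (FES Eu).
have {}dualP := dualP _ (subspaceZ (Num.sqrt (Q u u))^-1 sES Eu).
apply: (@le_trans _ _ (C%:E * `|F ((Num.sqrt (Q u u))^-1 *: u)|%:E)%E); last first.
  apply: lee_wpmul2l; first by rewrite lee_fin ltW.
  by apply: dualP; rewrite Qv -{2}Qq -exprMn mulVf// expr1n.
rewrite -EFinM lee_fin Fv; apply: le_trans (ler_wpM2l (ltW C0) (ler_norm _)).
rewrite mulrCA ler_pdivlMl//.
by apply: le_trans QF; rewrite -expr2 Qq.
Qed.

Lemma bounded_linear_functional_L2 f : L2 Omega f ->
  bounded_linear_functional gamma delta
    (fun v => \int[mu]_(x in Omega) (f x * v x)).
Proof.
move=> Lf.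
have -> : (fun v => \int[mu]_(x in Omega) (f x * v x)) = L2ip mu (f \_ Omega).
  apply/funext => v; rewrite Rintegral_mkcond; apply: eq_Rintegral => x _.
  by rewrite !patchE; case: ifPn => // _; rewrite mul0r.
have [sym lin _] := psd_L2ip mu.
have Lv v : ES v -> L2set mu v by move=> /FES[].
split=> [a u v /Lv Lu /Lv Lv'|].
  have := lin a _ _ _ Lu Lv' Lf.
  by rewrite ![L2ip mu _ (f \_ Omega)]L2ipC.
exists (Num.sqrt (L2ip mu (f \_ Omega) (f \_ Omega))) => v Ev.
rewrite (qnl_norm_energy_space Ev) -EFinM lee_fin.
have A0 := psd_ge0 (psd_L2ip mu) Lf.
rewrite -sqrtrM// -sqrtr_sqr; apply: ler_wsqrtr.
apply: le_trans (psd_cauchy_schwarz (subspace_L2set mu) (psd_L2ip mu) Lf (Lv _ Ev)) _.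
apply: ler_wpM2l => //; rewrite -lee_fin -(sqintE (Lv _ Ev)).
by have [] := energy_sobolev_parts (FES Ev).
Qed.

End well_posedness.

Theorem theorem3p1 (R : realType) (gamma : R -> R) (delta : R)
    (hgamma : admissible_kernel gamma) (hdelta0 : 0 < delta) (hdelta1 : delta < 1) :
  (exists C : R, forall F : (R -> R) -> R,
     bounded_linear_functional gamma delta F ->
     exists u : R -> R,
       [/\ variational_solution gamma delta F u,
           {ae lebesgue_measure, forall x, Omega_delta delta x -> u x = 0},
           forall w : R -> R, variational_solution gamma delta F w ->
             w = u %[ae lebesgue_measure] &
           (qnl_norm gamma delta u <= C%:E * dual_norm gamma delta F)%E]) /\
  (forall f : R -> R, L2 Omega f ->
     bounded_linear_functional gamma delta
       (fun v => \int[lebesgue_measure]_(x in Omega) (f x * v x))).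
Proof.
split; last by move=> f; exact: bounded_linear_functional_L2.
have [C C0 hC] := energy_sobolev_le_energy hgamma hdelta0.
have FES v : energy_space gamma delta v -> finite_energy gamma delta v.
  exact: energy_space_finite_energy.
exists C => F bF; have [u [Eu u0 uF]] := variational_existence hgamma hdelta0 bF.
exists u; split.
- split => // v Ev.
  by rewrite (b_qnl_energy hgamma hdelta0 (FES _ Eu) (FES _ Ev)) (uF _ Ev).
- apply: aeW => x xd; apply: u0 => /OmegaE/andP[x1 x2]; move: xd => [|/= x1'].
    by rewrite /= in_itv/= => /andP[_]; rewrite ltNge (ltW x1).
  by move: x2; rewrite x1' ltxx.
- move=> w [Ew wF].
  have sES := subspace_energy_space hgamma hdelta0.
  have Ewu := subspaceB sES Ew Eu.
  have Bwu : energy gamma delta (w - u) (w - u) = 0.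
    rewrite (psd_formBl (psd_energy hgamma hdelta0) (FES _ Ew) (FES _ Eu) (FES _ Ewu)).
    rewrite (uF _ Ewu); have := wF _ Ewu.
    rewrite (b_qnl_energy hgamma hdelta0 (FES _ Ew) (FES _ Ewu)) => -[->].
    by rewrite subrr.
  have [+ _ _] := energy_sobolev_parts (FES _ Ewu).
  have := hC _ Ewu; rewrite Bwu mulr0 -lee_fin => h1 /le_trans/(_ h1) h2.
  have [_ Lwu _ _ _] := FES _ Ewu.
  have s0 : sqint lebesgue_measure (w - u) = 0%E.
    by apply/eqP; rewrite eq_le h2 sqint_ge0.
  have := sqint_eq0 (L2set_measurable Lwu) s0.
  apply: (@filterS _ _ (ae_filter_ringOfSetsType lebesgue_measure)) => x /= h _.
  by apply/eqP; rewrite -subr_eq0; apply/eqP.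
- apply: (dual_norm_bound hgamma hdelta0 C0 bF Eu); rewrite -(uF _ Eu).
  exact: hC.
Qed.
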